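(* Let $n\geq 3$ and let $C_n$ be the cycle graph on vertices $1,\dots,n$, where vertex $j$ is adjacent exactly to $j-1$ and $j+1$ (indices mod $n$). Let $\sigma$ be any embedding of $C_n$ into a connected surface $\Sigma$. Then for every integer $m$ with $1\leq m<n$, $$\mathcal{D}_m(C_n,\sigma)=\sum_{j=0}^{m-1}(-1)^j\,(m-j)\binom{n}{m-j}=n\binom{n-2}{m-1}.$$
   Context: Graphs are finite and may have multiple edges and self-loops; a graph is viewed as a topological space (edges are copies of $[0,1]$ glued at endpoints). A subgraph is induced if it contains every edge of the ambient graph whose endpoints lie in its vertex set. For an embedding $\sigma$ of a graph $\Gamma$ into a connected surface $\Sigma$ and a connected subgraph $\Gamma'$, $f_\sigma(\Gamma')$ is the number of path components of $\Sigma\setminus\sigma(\Gamma')$; for a subgraph with connected components $\Gamma'_1,\dots,\Gamma'_k$, $f_\sigma(\Gamma')=\sum_j f_\sigma(\Gamma'_j)$. If $\Gamma$ has $v$ vertices and $1\le i\le v-1$, $\mathcal{D}_i(\Gamma,\sigma)=\sum f_\sigma(\Gamma')$, the sum running over all induced subgraphs $\Gamma'$ of $\Gamma$ with exactly $i$ vertices. *)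

(* Defs.v *)
From HB Require Import structures.
From mathcomp Require Import all_boot all_order all_algebra generic_quotient.
From mathcomp Require Import all_classical all_reals all_analysis.

Set Implicit Arguments.
Unset Strict Implicit.
Unset Printing Implicit Defensive.

Import Order.TTheory GRing.Theory Num.Theory.
Import numFieldNormedType.Exports.

Local Open Scope classical_set_scope.
Local Open Scope ring_scope.
Local Open Scope quotient_scope.

(* Finite multigraphs: parallel edges and loops are allowed.  The orientation
   of an edge from [src] to [tgt] only serves to parametrize it by [0,1]. *)
Record graph := Graph {
  vert : finType;
  edge : finType;
  src : edge -> vert;
  tgt : edge -> vert }.

Section Realization.
Context (R : realType) (G : graph).

(* One point for each vertex and one copy of [0,1] for each edge. *)
Definition cell (c : (vert G + edge G)%type) : topologicalType :=
  match c with
  | inl _ => discrete_topology unit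
  | inr _ => set_type (`[0%R, 1%R] : set R)
  end.

Definition cells : topologicalType := {c : (vert G + edge G)%type & cell c}.

Definition vertex_pt (v : vert G) : cells :=
  existT (fun c => cell c : Type) (inl v) tt.

Definition edge_pt (e : edge G) (t : set_type (`[0%R, 1%R] : set R)) : cells :=
  existT (fun c => cell c : Type) (inr e) t.

(* Sends the two ends of every edge to the vertices they are glued to, and
   fixes every other point; two points are identified when their images
   under [glue_ends] agree. *)
Definition glue_ends (x : cells) : cells :=
  match x with
  | existT (inl v) _ => vertex_pt v
  | existT (inr e) t =>
      if set_val t == 0 then vertex_pt (src e)
      else if set_val t == 1 then vertex_pt (tgt e)
      else edge_pt e t
  end.

Definition glue_rel (x y : cells) : bool := glue_ends x == glue_ends y.

Lemma glue_rel_refl : reflexive glue_rel.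
Proof. by move=> x; exact: eqxx. Qed.

Lemma glue_rel_sym : symmetric glue_rel.
Proof. by move=> x y; exact: eq_sym. Qed.

Lemma glue_rel_trans : transitive glue_rel.
Proof. by move=> y x z /eqP xy /eqP yz; apply/eqP; rewrite xy. Qed.

Definition glue_equiv : equiv_rel cells :=
  EquivRel glue_rel glue_rel_refl glue_rel_sym glue_rel_trans.

Definition realization : topologicalType :=
  quotient_topology {eq_quot glue_equiv}.

Definition realization_pi (x : cells) : realization :=
  \pi_({eq_quot glue_equiv}) x.

End Realization.

Section Subgraphs.
Context (G : graph).

Definition is_subgraph (H : {set vert G} * {set edge G}) : bool :=
  [forall e in H.2, (src e \in H.1) && (tgt e \in H.1)].

Record subgraph := Subgraph {
  sub_sets :> {set vert G} * {set edge G};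
  sub_subgraph : is_subgraph sub_sets }.

HB.instance Definition _ := [isSub for sub_sets].
HB.instance Definition _ := [Finite of subgraph by <:].

Definition sub_vert (H : subgraph) : {set vert G} := H.1.
Definition sub_edge (H : subgraph) : {set edge G} := H.2.

Definition is_induced (H : subgraph) : bool :=
  [forall e : edge G, (src e \in sub_vert H) && (tgt e \in sub_vert H)
                      ==> (e \in sub_edge H)].

Definition adj (H : subgraph) : rel (vert G) := fun u v =>
  [exists e in sub_edge H, ((src e == u) && (tgt e == v))
                           || ((src e == v) && (tgt e == u))].

(* The vertices reachable from [v] in [H], with all edges of [H] between
   them. *)
Definition component_sets (H : subgraph) (v : vert G) :
    {set vert G} * {set edge G} :=
  ([set u | connect (adj H) v u]%SET,
   [set e in sub_edge H | connect (adj H) v (src e)]%SET).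

Lemma component_subgraph (H : subgraph) (v : vert G) :
  is_subgraph (component_sets H v).
Proof.
apply/forall_inP => e; rewrite !inE => /andP[eH vs]; rewrite vs /=.
apply: (connect_trans vs); apply: connect1.
by apply/exists_inP; exists e => //; rewrite !eqxx.
Qed.

Definition component (H : subgraph) (v : vert G) : subgraph :=
  Subgraph (component_subgraph H v).

Definition components (H : subgraph) : {set subgraph} :=
  [set component H v | v in sub_vert H]%SET.

Definition sub_realization (R : realType) (H : subgraph) :
    set (realization R G) :=
  @realization_pi R G @` [set x | match projT1 x with
                                  | inl v => v \in sub_vert H
                                  | inr e => e \in sub_edge H
                                  end].

End Subgraphs.

Definition embedding (X Y : topologicalType) (f : X -> Y) : Prop :=
  [/\ injective f, continuous f
    & forall U : set X, open U -> exists2 W : set Y, open W & U = f @^-1` W].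

Definition homeomorphic_sets (X Y : topologicalType) (A : set X) (B : set Y) :
    Prop :=
  exists (f : X -> Y) (g : Y -> X),
    [/\ {within A, continuous f}, {within B, continuous g},
        f @` A `<=` B, g @` B `<=` A
      & {in A, cancel f g} /\ {in B, cancel g f}].

(* Surfaces are without boundary, and need not be compact or orientable. *)
Definition surface (R : realType) (S : topologicalType) : Prop :=
  [/\ hausdorff_space S, @second_countable S
    & forall x : S, exists (U : set S) (V : set (R * R)%type),
        [/\ open U, U x, open V & homeomorphic_sets U V]].

Section PathComponents.
Context (R : realType) (S : topologicalType).

Definition path_connected_in (A : set S) (x y : S) : Prop :=
  exists gamma : R -> S,
    [/\ {within `[0, 1], continuous gamma}, gamma @` `[0, 1] `<=` A,
        gamma 0 = x & gamma 1 = y].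

Definition path_component (A : set S) (x : S) : set S :=
  [set y | path_connected_in A x y].

Definition path_components (A : set S) : set (set S) :=
  path_component A @` A.

End PathComponents.

Section FaceCount.
Context (R : realType) (G : graph) (S : topologicalType).
Context (sigma : realization R G -> S).

(* [counting] is +oo on infinite sets, so no finiteness is presupposed. *)
Definition faces_connected (H : subgraph G) : \bar R :=
  counting (path_components R (~` (sigma @` sub_realization H))).

Definition faces (H : subgraph G) : \bar R :=
  (\sum_(K in components H) faces_connected K)%E.

Definition face_sum (i : nat) : \bar R :=
  (\sum_(H : subgraph G | is_induced H && (#|sub_vert H| == i)) faces H)%E.

End FaceCount.

(* The vertices 1, ..., n are represented by 0, ..., n - 1, and edge [i] joins
   [i] to its cyclic successor. *)
Definition cycle_graph (n : nat) : graph :=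
  @Graph 'I_n 'I_n id (@ordS n).

(* Main.v *)
(* A component of a proper nonempty induced subgraph of [C_n] is a path, so its
   image is an arc; since an arc does not separate a connected surface, every
   such component has exactly one face, and a subgraph has as many components
   as vertices [i] in it whose successor [i + 1] is not.  For each [i] there are
   binom(n - 2, m - 1) such subgraphs with [m] vertices.

   That an arc does not separate follows by adding short subarcs one at a time.
   A subarc [B] lying in a disk and meeting the previous part [A] only in an end
   point does not separate two nearby points [x], [y] off [A]: in the plane, the
   argument of [(z - x) / (z - y)] has a continuous branch on [A] (and on the
   outside of the disk) because [x] and [y] are close, and on [B] because [B] is
   an arc, and the two branches can be matched at the common point.  A branch on
   a closed set with bounded complement extends to the whole plane, and if [x]
   and [y] were separated it would yield a nowhere vanishing planar vector field
   that winds once along a large circle. *)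

From HB Require Import structures.
Require Import Defs.
From mathcomp Require Import all_boot all_order all_algebra generic_quotient.
From mathcomp Require Import all_classical all_reals all_analysis.
From mathcomp Require Import ring lra zify.

Set Implicit Arguments.
Unset Strict Implicit.
Unset Printing Implicit Defensive.

Import Order.TTheory GRing.Theory Num.Theory.
Import numFieldNormedType.Exports.

Local Open Scope classical_set_scope.
Local Open Scope ring_scope.
Local Open Scope quotient_scope.

(** * Angle functions *)

Section Angles.
Context {R : realType}.
Implicit Types (w z : R * R) (t : R).

(** A relation, because the argument is only determined up to full turns: every branch qualifies,
    and [w] is forced to be nonzero. *)
Definition polar w t := exists2 r : R, 0 < r & w = (r * cos t, r * sin t).

(* [w * conj z] as complex numbers: its argument is the angle from [z] to [w]. *)
Definition cdiv w z : R * R := (w.1 * z.1 + w.2 * z.2, w.2 * z.1 - w.1 * z.2).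

(** The Euclidean norm, as opposed to the norm of [R * R], which is the maximum norm. *)
Definition nrm w : R := Num.sqrt (w.1 ^+ 2 + w.2 ^+ 2).

Lemma nrm_gt0 w : w != 0 -> 0 < nrm w.
Proof.
move=> w0; rewrite /nrm sqrtr_gt0 lt_def addr_ge0 ?sqr_ge0// andbT.
apply: contra w0; rewrite paddr_eq0 ?sqr_ge0// !sqrf_eq0.
by case: w => a b /= /andP[/eqP-> /eqP->].
Qed.

Lemma nrm_sqr w : nrm w ^+ 2 = w.1 ^+ 2 + w.2 ^+ 2.
Proof. by rewrite sqr_sqrtr// addr_ge0 ?sqr_ge0. Qed.

Lemma polar_unit w t : polar w t ->
  w = (nrm w * cos t, nrm w * sin t).
Proof.
move=> [r r0 ->]; congr pair; congr (_ * _);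
  rewrite /nrm /= !exprMn -mulrDr cos2Dsin2 mulr1 sqrtr_sqr gtr0_norm//.
Qed.

Lemma polar_neq0 w t : polar w t -> w != 0.
Proof.
move=> [r r0 ->]; apply/eqP => -[/eqP + /eqP].
rewrite !mulf_eq0 gt_eqF//= => /eqP c0 /eqP s0.
by have := cos2Dsin2 t; rewrite c0 s0 !expr0n/= addr0 => /eqP; rewrite eq_sym oner_eq0.
Qed.

Lemma polar_scale c w t : 0 < c -> polar w t -> polar (c * w.1, c * w.2) t.
Proof.
by move=> c0 [r r0 ->]; exists (c * r); rewrite ?mulr_gt0//= !mulrA.
Qed.

Lemma polar_half_plane w : 0 < w.1 -> polar w (atan (w.2 / w.1)).
Proof.
move=> w0; set u := w.2 / w.1.
have c0 : 0 < cos (atan u).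
  by apply: cos_gt0_pihalf; rewrite atan_gtNpi2 atan_ltpi2.
exists (w.1 / cos (atan u)); first by rewrite divr_gt0.
have e : sin (atan u) = u * cos (atan u).
  by rewrite -{2}(atanK u) /tan divfK// gt_eqF.
rewrite e divfK ?gt_eqF// [LHS]surjective_pairing; congr pair.
by rewrite /u; field; rewrite !lt0r_neq0.
Qed.

Lemma polar_cdiv w z s t : polar w s -> polar z t -> polar (cdiv w z) (s - t).
Proof.
move=> [r r0 ->] [q q0 ->]; exists (r * q); first by rewrite mulr_gt0.
by rewrite /cdiv /= cosB sinB; congr pair; ring.
Qed.

Lemma polar_cdivK w z s t : polar (cdiv w z) s -> polar z t -> polar w (s + t).
Proof.
move=> [r r0 e] [q q0 ez]; exists (r / q); first by rewrite divr_gt0.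
case: w e ez => [a b] [e1 e2] ez; rewrite cosD sinD.
have q1 : z.1 ^+ 2 + z.2 ^+ 2 = q ^+ 2.
  by rewrite ez /= !exprMn -mulrDr cos2Dsin2 mulr1.
have q2 : q ^+ 2 != 0 by rewrite expf_neq0// gt_eqF.
(* Recovers [w] as [cdiv w z] times [z], divided by the square of the modulus of [z]. *)
have -> : (a, b) = (((a * z.1 + b * z.2) * z.1 - (b * z.1 - a * z.2) * z.2) / q ^+ 2,
    ((b * z.1 - a * z.2) * z.1 + (a * z.1 + b * z.2) * z.2) / q ^+ 2).
  by congr pair; apply: (mulIf q2); rewrite divfK// -q1; ring.
rewrite e1 e2 ez /=; congr pair; field; exact: lt0r_neq0.
Qed.

(** A cosine equal to 1 encodes equality of angles modulo full turns; [polar_shift] is the converse,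
    and no integer multiple of [2 * pi] has to be named. *)
Lemma polar_eq w s t : polar w s -> polar w t -> cos (s - t) = 1.
Proof.
move=> /polar_unit h1 /[dup]/polar_neq0/nrm_gt0 w0 /polar_unit h2.
have [e1 e2] : cos s = cos t /\ sin s = sin t.
  move: h2; rewrite {1}h1 => -[/(mulfI (lt0r_neq0 w0))-> /(mulfI (lt0r_neq0 w0))->].
  by [].
by rewrite cosB e1 e2 -!expr2 cos2Dsin2.
Qed.

Lemma polar_shift w t c : polar w t -> cos c = 1 -> polar w (t + c).
Proof.
move=> [r r0 ->] c1; have s0 : sin c = 0.
  by apply/eqP; rewrite -sqrf_eq0 sin2cos2 c1 expr1n subrr.
by exists r => //; rewrite cosD sinD c1 s0 !mulr1 !mulr0 subr0 addr0.
Qed.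

(* The partial quotients [H k.+1 / H k] lie in the right half plane, where the
   principal argument is continuous. *)
Lemma lift_steps (X : topologicalType) (H : nat -> X -> R * R) (t0 : X -> R) N :
  (forall k, continuous (fun x => (H k x).1)) ->
  (forall k, continuous (fun x => (H k x).2)) ->
  (forall k x, (k < N)%N -> 0 < (cdiv (H k.+1 x) (H k x)).1) ->
  continuous t0 -> (forall x, polar (H 0%N x) (t0 x)) ->
  exists2 t : X -> R, continuous t & forall x, polar (H N x) (t x).
Proof.
move=> c1 c2 + ct0 pt0; elim: N => [|N IH] pos; first by exists t0.
have [t ct pt] := IH (fun k x kN => pos k x (ltnW kN)).
pose q x := cdiv (H N.+1 x) (H N x).
exists (fun x => atan ((q x).2 / (q x).1) + t x) => [|x].
  move=> x; apply: continuousD; last exact: ct.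
  apply: (@continuous_comp _ _ _ (fun x => (q x).2 / (q x).1) atan);
    last exact: continuous_atan.
  apply: continuousM.
    by apply: continuousB; apply: continuousM; [exact: c2|exact: c1|exact: c1|exact: c2].
  apply: continuousV; first by rewrite gt_eqF// pos.
  by apply: continuousD; apply: continuousM; [exact: c1|exact: c1|exact: c2|exact: c2].
by apply: polar_cdivK (pt x); apply: polar_half_plane; exact: pos.
Qed.

Lemma polar_exists w : w != 0 -> exists t, polar w t.
Proof.
move=> w0; case: w w0 => a b w0.
have [a0|a0|a0] := ltrgtP a 0.
- have na0 : 0 < (- a, - b).1 by rewrite /= oppr_gt0.
  have [r r0] := polar_half_plane na0; rewrite /= invrN mulrNN => -[e1 e2].
  exists (atan (b / a) + pi); exists r => //; rewrite cosDpi sinDpi !mulrN.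
  by rewrite -e1 -e2 !opprK.
- by exists (atan (b / a)); apply: (@polar_half_plane (a, b)).
have b0 : b != 0 by apply: contra w0 => /eqP->; rewrite a0.
have [b1|b1] := ltP 0 b.
  by exists (pi / 2), b => //; rewrite cos_pihalf sin_pihalf a0 mulr0 mulr1.
exists (pi + pi / 2); exists (- b).
  by rewrite oppr_gt0 lt_neqAle b0 b1.
by rewrite addrC cosDpi sinDpi cos_pihalf sin_pihalf a0 oppr0 mulr0 mulrNN mulr1.
Qed.

End Angles.

(** The Lebesgue number lemma, with the cover replaced by a property of sets that passes to
    subsets. *)
Lemma lebesgue_number (R : realType) (X : pseudoMetricType R) (C : set X)
    (Q : set X -> Prop) :
  compact C -> (forall A B, A `<=` B -> Q B -> Q A) ->
  (forall x, C x -> exists2 A, nbhs x A & Q A) ->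
  exists2 d : R, 0 < d & forall x, C x -> Q (ball x d).
Proof.
move=> /compact_near_coveringP cC QS CQ.
have {cC} H : \forall d \near (0 : R)^'+, C `<=` (fun x => Q (ball x d)).
  apply: cC => x /CQ[A /nbhs_ballP[e /= e0 eA] QA].
  (* Half the radius, so that for [z] in this ball the ball of radius [d] about [z] still lies in
     the ball of radius [e] about [x]. *)
  exists (ball x (e / 2), [set d | d < e / 2]) => /=.
    split; first by apply: nbhsx_ballx; rewrite divr_gt0.
    by apply: nbhs_right_lt; rewrite divr_gt0.
  move=> [z d] /= [xz de]; apply: QS QA => w zw; apply: eA.
  by apply: ball_split xz _; apply: le_ball zw; exact: ltW.
have [d [d0 dC]] := filter_ex (filterI (nbhs_right_gt (0 : R)) H).
by exists d.
Qed.

(* Contracting [C] to the origin in steps so short that [v] stays within a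
   quarter turn, the angle of [v] is lifted step by step. *)
Lemma star_lift (R : realType) (X : normedModType R) (C : set X)
    (v : X -> R * R) (rho : X -> X) (M : R) :
  compact C -> (forall x, C x -> `|x| <= M) ->
  (forall (a : R) x, 0 <= a <= 1 -> C x -> C (a *: x)) ->
  continuous v -> (forall x, C x -> v x != 0) ->
  continuous rho -> (forall x, C (rho x)) ->
  exists2 t : X -> R, continuous t & forall x, polar (v (rho x)) (t x).
Proof.
move=> cC CM Cs cv v0 crho Crho.
have c1 : continuous (fun x => (v x).1).
  by move=> x; apply: (@continuous_comp _ _ _ v fst); [exact: cv|exact: cvg_fst].
have c2 : continuous (fun x => (v x).2).
  by move=> x; apply: (@continuous_comp _ _ _ v snd); [exact: cv|exact: cvg_snd].
(* On a set with this property any two values of [v] are less than a quarter turn apart. *)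
pose Q (A : set X) := forall x y, A x -> A y -> 0 < (cdiv (v x) (v y)).1.
have [||d d0 dQ] := @lebesgue_number R X C Q cC.
- by move=> A B AB QB x y /AB Bx /AB; exact: QB.
- move=> x Cx.
  have vx0 : 0 < (v x).1 ^+ 2 + (v x).2 ^+ 2 by rewrite -nrm_sqr exprn_gt0// nrm_gt0// v0.
  have cQ : {for (x, x), continuous (fun p : X * X => (cdiv (v p.1) (v p.2)).1)}.
    apply: continuousD; apply: continuousM.
    - by apply: (@continuous_comp _ _ _ fst (fun x => (v x).1));
        [exact: cvg_fst|exact: c1].
    - by apply: (@continuous_comp _ _ _ snd (fun x => (v x).1));
        [exact: cvg_snd|exact: c1].
    - by apply: (@continuous_comp _ _ _ fst (fun x => (v x).2));
        [exact: cvg_fst|exact: c2].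
    - by apply: (@continuous_comp _ _ _ snd (fun x => (v x).2));
        [exact: cvg_snd|exact: c2].
  have [[A B] /= [nA nB] AB] : nbhs (x, x) [set p : X * X | 0 < (cdiv (v p.1) (v p.2)).1].
    by apply: (cQ [set r | 0 < r]); apply: open_nbhs_nbhs; split;
      [exact: open_gt|rewrite /= /cdiv/= -!expr2].
  exists (A `&` B); first exact: filterI.
  by move=> y z [Ay _] [_ Bz]; apply: (AB (y, z)).
have C0 : C 0 by rewrite -(scale0r (rho 0)); apply: Cs; rewrite ?lexx ?ler01.
have [t0 pt0] := polar_exists (v0 _ C0).
(* Contracting in [N] steps moves each point by at most [M / N] at a time, which is below the
   Lebesgue number [d]. *)
pose N := (Num.trunc (`|M| / d)).+1.
have NM : M / N%:R < d.
  rewrite ltr_pdivrMr ?ltr0n// mulrC -ltr_pdivrMr//.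
  apply: le_lt_trans (_ : `|M| / d < _); first by rewrite ler_pM2r ?invr_gt0// ler_norm.
  exact: truncnS_gt.
pose H k x := v (k%:R / N%:R *: rho x).
have cH k : continuous (fun x => k%:R / N%:R *: rho x).
  by move=> x; apply: cvgZ; [exact: cvg_cst|exact: crho].
have kN k : (k <= N)%N -> 0 <= k%:R / N%:R <= (1 : R).
  by move=> kN; rewrite divr_ge0//= ler_pdivrMr ?ltr0n// mul1r ler_nat.
have [||||| t ct pt] := @lift_steps R X H (fun=> t0) N.
- by move=> k x; apply: (continuous_comp (cH k x) (c1 _)).
- by move=> k x; apply: (continuous_comp (cH k x) (c2 _)).
- move=> k x kn; apply: (dQ (k%:R / N%:R *: rho x)).
  + by apply: Cs => //; exact/kN/ltnW.
  + rewrite -ball_normE /= -scalerBl normrZ.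
    have -> : k%:R / N%:R - k.+1%:R / N%:R = - (N%:R : R)^-1.
      by rewrite -natr1; field; rewrite pnatr_eq0.
    rewrite normrN ger0_norm ?invr_ge0// mulrC; apply: le_lt_trans NM.
    by rewrite ler_pM2r ?invr_gt0// CM.
  + exact: ballxx.
- by move=> x; exact: cvg_cst.
- by move=> x; rewrite /H mul0r scale0r.
by exists t => // x; have := pt x; rewrite /H divff ?pnatr_eq0// scale1r.
Qed.

(** * Paths *)

Lemma within_comp (X Y Z : topologicalType) (A : set X) (B : set Y)
    (f : X -> Y) (g : Y -> Z) :
  {within A, continuous f} -> {within B, continuous g} ->
  (forall x, A x -> B (f x)) -> {within A, continuous (g \o f)}.
Proof.
move=> /subspace_continuousP cf /subspace_continuousP cg fAB.
apply/subspace_continuousP => x Ax U nU.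
have nV := cg _ (fAB _ Ax) U nU.
have nW : nbhs x (fun z => A z -> B (f z) -> U (g (f z))) := cf _ Ax _ nV.
move: nW; apply: filterS => z h Az.
by apply: h => //; exact: fAB.
Qed.

(** The image of a closed subset of [C] is compact, hence closed in the Hausdorff space [X]; so the
    inverse pulls closed sets back to closed sets. *)
Lemma arc_inverse (T : ptopologicalType) (X : topologicalType) (C : set T)
    (b : T -> X) :
  hausdorff_space X -> compact C -> {within C, continuous b} ->
  (forall u v, C u -> C v -> b u = b v -> u = v) ->
  exists2 c : X -> T, {within b @` C, continuous c} &
    forall u, C u -> c (b u) = u.
Proof.
move=> hX cC cb ib.
have : forall z, exists u, (b @` C) z -> C u /\ b u = z.
  move=> z; have [[u Cu bu]|nz] := pselect ((b @` C) z); first by exists u.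
  by exists point.
move=> /choice[c cP].
have cK u : C u -> c (b u) = u.
  by move=> Cu; have [Ccu ?] := cP (b u) (imageP b Cu); exact: ib.
exists c => //; apply/continuous_closedP => F clF; apply/closed_subspaceP.
exists (b @` (C `&` F)).
  apply: compact_closed => //; apply: continuous_compact.
    by apply: continuous_subspaceW cb => u [].
  exact: compact_closedI.
apply/seteqP; split=> z [].
  move=> [u [Cu Fu] <-] bz; split=> //; rewrite /preimage/= /from_subspace cK//.
move=> Fcz [u Cu bu]; split; last by exists u.
by exists u => //; split=> //; move: Fcz; rewrite -bu /preimage /= /from_subspace cK.
Qed.

Section Paths.
Context {R : realType}.

Lemma path_refl (X : topologicalType) (A : set X) x :
  A x -> path_connected_in R A x x.
Proof.
move=> Ax; exists (fun=> x); split => //; last by move=> _ [t _ <-].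
by apply: continuous_subspaceT => ?; exact: cvg_cst.
Qed.

Lemma path_comp (X Y : topologicalType) (A : set X) (B : set Y) (f : X -> Y) x y :
  {within A, continuous f} -> (forall z, A z -> B (f z)) ->
  path_connected_in R A x y -> path_connected_in R B (f x) (f y).
Proof.
move=> cf fAB [g [cg gA <- <-]]; exists (f \o g); split=> //.
  by apply: (within_comp cg cf) => t ht; apply: gA; exists t.
by move=> _ [t ht <-]; apply: fAB; apply: gA; exists t.
Qed.

Lemma path_sub (X : topologicalType) (A B : set X) x y :
  A `<=` B -> path_connected_in R A x y -> path_connected_in R B x y.
Proof.
by move=> AB; apply: path_comp AB; apply: continuous_subspaceT => z; exact: cvg_id.
Qed.

Lemma path_trans (X : topologicalType) (A : set X) x y z :
  path_connected_in R A x y -> path_connected_in R A y z ->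
  path_connected_in R A x z.
Proof.
move=> [f [cf fA f0 f1]] [g [cg gA g0 g1]].
pose h (t : R) := if t <= 1 / 2 then f (2 * t) else g (2 * t - 1).
have hf t : t \in `[0, 1 / 2]%classic -> f (2 * t) = h t.
  by rewrite inE /= in_itv /= /h => /andP[_ ->].
have hg t : t \in `[1 / 2, 1]%classic -> g (2 * t - 1) = h t.
  rewrite inE /= in_itv /= /h => /andP[t2 _]; case: ifP => // t1.
  have -> : t = 1 / 2 by apply/eqP; rewrite eq_le t1 t2.
  by rewrite mulrC divfK ?pnatr_eq0// subrr g0 f1.
exists h; split.
- have -> : `[0, 1]%classic = `[0, 1 / 2]%classic `|` `[1 / 2, 1]%classic :> set R.
    apply/seteqP; split=> t /=; rewrite !in_itv /=.
      by move=> /andP[t0 t1]; rewrite t0 t1 /= andbT; case: (leP t (1 / 2)) => [|/ltW];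
        [left|right].
    by case=> /andP[t0 t1]; apply/andP; split; lra.
  apply: withinU_continuous; try exact: itv_closed.
  + apply: (@subspace_eq_continuous _ _ _ (f \o (fun t => 2 * t))) hf _;
      apply: within_comp cf _.
      by apply: continuous_subspaceT => t; apply: cvgM; [exact: cvg_cst|exact: cvg_id].
    by move=> t /=; rewrite !in_itv /= => /andP[t0 t1]; apply/andP; split; lra.
  + apply: (@subspace_eq_continuous _ _ _ (g \o (fun t => 2 * t - 1))) hg _;
      apply: within_comp cg _.
      apply: continuous_subspaceT => t; apply: cvgB; last exact: cvg_cst.
      by apply: cvgM; [exact: cvg_cst|exact: cvg_id].
    by move=> t /=; rewrite !in_itv /= => /andP[t0 t1]; apply/andP; split; lra.
- move=> _ [t + <-]; rewrite /h /= in_itv /= => /andP[t0 t1]; case: leP => t2.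
    by apply: fA; exists (2 * t) => //=; rewrite in_itv /=; apply/andP; split; lra.
  by apply: gA; exists (2 * t - 1) => //=; rewrite in_itv /=; apply/andP; split; lra.
- by rewrite /h divr_ge0 ?ler01// mulr0.
- rewrite /h ifF; last by apply/negbTE; rewrite -ltNge; lra.
  by rewrite (_ : 2 * 1 - 1 = 1) //; lra.
Qed.

Lemma path_ball (V : normedModType R) (c x y : V) r :
  ball c r x -> ball c r y -> path_connected_in R (ball c r) x y.
Proof.
rewrite -!ball_normE /= => cx cy.
exists (fun t => (1 - t) *: x + t *: y); split.
- apply: continuous_subspaceT => t; apply: cvgD.
    by apply: cvgZ; [apply: cvgB; [exact: cvg_cst|exact: cvg_id]|exact: cvg_cst].
  by apply: cvgZ; [exact: cvg_id|exact: cvg_cst].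
- move=> _ [t + <-]; rewrite /= in_itv /= => /andP[t0 t1].
  have -> : c - ((1 - t) *: x + t *: y) = (1 - t) *: (c - x) + t *: (c - y).
    by rewrite !scalerBr addrACA -scalerDl subrK scale1r opprD.
  apply: le_lt_trans (ler_normD _ _) _; rewrite !normrZ !ger0_norm ?subr_ge0//.
  (* At [t = 0] the strict bound comes from [x]; otherwise the term in [y] is strict. *)
  have [->|tn] := eqVneq t 0; first by rewrite subr0 mul1r mul0r addr0.
  have t0' : 0 < t by rewrite lt_neqAle eq_sym tn.
  have h1 : t * `|c - y| < t * r by rewrite ltr_pM2l.
  have h2 : (1 - t) * `|c - x| <= (1 - t) * r by rewrite ler_wpM2l ?subr_ge0// ltW.
  lra.
- by rewrite subr0 scale1r scale0r addr0.
- by rewrite subrr scale1r scale0r add0r.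
Qed.

End Paths.

(** * Arcs in the plane *)

Section Plane.
Context {R : realType}.
Implicit Types x y z : R * R.

Lemma continuous_fst_sub x : continuous (fun z => (z - x).1).
Proof. by move=> z; apply: continuousB; [exact: cvg_fst|exact: cvg_cst]. Qed.

Lemma continuous_snd_sub x : continuous (fun z => (z - x).2).
Proof. by move=> z; apply: continuousB; [exact: cvg_snd|exact: cvg_cst]. Qed.

Lemma continuous_nrm_sub x : continuous (fun z => nrm (z - x)).
Proof.
move=> z; apply: (@continuous_comp _ _ _ (fun z => (z - x).1 ^+ 2 + (z - x).2 ^+ 2)
  Num.sqrt).
  apply: continuousD; apply: continuousM;
    solve [exact: continuous_fst_sub|exact: continuous_snd_sub].
exact: sqrt_continuous.
Qed.

Lemma continuous_pair (X : topologicalType) (f g : X -> R) :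
  continuous f -> continuous g -> continuous (fun u => (f u, g u)).
Proof. by move=> cf cg u; exact: cvg_pair (cf u) (cg u). Qed.

(** Retracts the line onto a segment; through it, maps given on a segment or a square become total
    and continuous. *)
Definition clamp (a b t : R) := Num.max a (Num.min b t).

Lemma continuous_clamp a b : continuous (clamp a b).
Proof.
move=> t; apply: continuous_max; first exact: cvg_cst.
by apply: continuous_min; [exact: cvg_cst|exact: cvg_id].
Qed.

Lemma clamp_itv a b t : a <= b -> a <= clamp a b t <= b.
Proof. by move=> ab; rewrite /clamp le_max lexx /= ge_max ab ge_min lexx. Qed.

Lemma clampE a b t : a <= t <= b -> clamp a b t = t.
Proof. by move=> /andP[at_ tb]; rewrite /clamp min_r// max_r. Qed.

(** The difference [f s - s] takes only multiples of a full turn. If [f] returned to its initial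
    value, the difference would drop by [2 * pi], hence pass through a value half a turn off, where
    the cosine is -1. *)
Lemma circle_angle (f : R -> R) : continuous f ->
  (forall s, cos (f s - s) = 1) -> f 0 != f (pi *+ 2).
Proof.
move=> cf fs; apply/eqP => f02.
pose d s := f s - s.
have cd : continuous d by move=> s; apply: continuousB; [exact: cf|exact: cvg_id].
have p0 : (0 : R) <= pi *+ 2 by rewrite mulrn_wge0// pi_ge0.
have e2 : d (pi *+ 2) = d 0 - pi - pi by rewrite /d -f02 mulr2n subr0 opprD addrA.
have [||s _ ds] := @IVT R d 0 (pi *+ 2) (d 0 - pi) p0.
- exact: continuous_subspaceT.
- rewrite ge_min le_max e2; have := pi_gt0 R; move: (d 0) => w ?.
  by apply/andP; split; apply/orP; [right|left]; lra.
have c0 : cos (d 0) = 1 by exact: fs.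
have cs : cos (d s) = 1 by exact: fs.
by move: c0; rewrite -(subrK pi (d 0)) cosDpi -ds cs; lra.
Qed.

(* Otherwise the path component [U] of [x] in the complement of [K] is bounded
   and misses [y].  The unit field equal to [exp(i t) * (z - y) / |z - y|] on
   [U] and to [(z - x) / |z - x|] off [U] would be continuous and nowhere zero
   on a large square, hence have an angle there, although it winds once along a
   large circle. *)
Lemma path_of_angle (K : set (R * R)) (t : R * R -> R) x y M :
  closed K -> ~ K x -> ~ K y -> (forall z, ~ K z -> `|z| <= M) ->
  continuous t -> (forall z, K z -> polar (cdiv (z - x) (z - y)) (t z)) ->
  path_connected_in R (~` K) x y.
Proof.
move=> clK Kx Ky KM ct pt; apply: contrapT => nU.
pose U := path_component R (~` K) x.
have Uloc z : ~ K z -> exists2 e : R, 0 < e & ball z e `<=` ~` K.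
  move=> Kz; have : nbhs z (~` K).
    by apply: open_nbhs_nbhs; split => //; exact: closed_openC.
  by move=> /nbhs_ballP[e /= e0 eK]; exists e.
have UK z : U z -> ~ K z.
  by move=> [g [_ gK _ <-]]; apply: (gK _); exists 1 => //=; rewrite in_itv /= ler01 lexx.
have ballU z e w w' : ball z e `<=` ~` K -> ball z e w -> ball z e w' -> U w -> U w'.
  move=> eK zw zw' Uw; apply: path_trans Uw _; apply: path_sub eK _; exact: path_ball.
have Uopen z : U z -> nbhs z U.
  move=> Uz; have [e e0 eK] := Uloc _ (UK _ Uz); apply/nbhs_ballP; exists e => //= w zw.
  by apply: (ballU z e z) => //; exact: ballxx.
have oU : open U by move=> z; exact: Uopen.
(* Thus the frontier of [U] lies in [K], the only place where the two formulas for the field have to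
   agree. *)
have Ucl z : closure U z -> ~ K z -> U z.
  move=> clUz /Uloc[e e0 eK]; have [w [Uw zw]] := clUz _ (nbhsx_ballx z e e0).
  by apply: (ballU z e w) => //; exact: ballxx.
have Ux : U x by exact: path_refl.
have ncy : ~ closure U y by move=> /Ucl /(_ Ky).
have xM : `|x| <= M by exact: KM.
have cfs a := @continuous_fst_sub a.
have csn a := @continuous_snd_sub a.
have cnr a := @continuous_nrm_sub a.
have nz a z : z != a -> nrm (z - a) != 0.
  by move=> za; rewrite gt_eqF// nrm_gt0// subr_eq0.
pose gin1 z := (cos (t z) * (z - y).1 - sin (t z) * (z - y).2) / nrm (z - y).
pose gin2 z := (sin (t z) * (z - y).1 + cos (t z) * (z - y).2) / nrm (z - y).
pose gout1 z := (z - x).1 / nrm (z - x).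
pose gout2 z := (z - x).2 / nrm (z - x).
(* On [K], rotating [z - y] by [t z] gives the direction of [z - x]. *)
have agree z : K z -> gin1 z = gout1 z /\ gin2 z = gout2 z.
  move=> Kz; have zy : z - y != 0 by rewrite subr_eq0; apply: contra_notN Ky => /eqP <-.
  have zx : z - x != 0 by rewrite subr_eq0; apply: contra_notN Kx => /eqP <-.
  have [s ps] := polar_exists zy.
  have /polar_unit ex := polar_cdivK (pt z Kz) ps.
  move: ps => /polar_unit ey.
  have nx := lt0r_neq0 (nrm_gt0 zx).
  have ny := lt0r_neq0 (nrm_gt0 zy).
  have [ey1 ey2] : (z - y).1 = nrm (z - y) * cos s /\ (z - y).2 = nrm (z - y) * sin s.
    by split; [exact: (congr1 fst ey)|exact: (congr1 snd ey)].
  have [ex1 ex2] : (z - x).1 = nrm (z - x) * cos (t z + s) /\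
      (z - x).2 = nrm (z - x) * sin (t z + s).
    by split; [exact: (congr1 fst ex)|exact: (congr1 snd ex)].
  rewrite /gin1 /gin2 /gout1 /gout2 ex1 ex2 ey1 ey2 cosD sinD.
  by split; field; rewrite nx ny.
(* The closure of [U] and the complement of [U] are closed, cover the plane and overlap inside [K],
   so continuous pieces that agree on [K] glue. *)
pose sel (f g : R * R -> R) z := if z \in U then f z else g z.
have csel f g : {in closure U, continuous f} -> {in ~` U, continuous g} ->
    (forall z, K z -> f z = g z) -> continuous (sel f g).
  move=> cf cg fg; apply/continuous_subspace_setT.
  have -> : setT = closure U `|` ~` U.
    apply/seteqP; split=> // z _; have [Uz|?] := pselect (U z); last by right.
    by left; exact: subset_closure.
  apply: withinU_continuous; first exact: closed_closure.
  - exact: open_closedC.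
  - apply: (@subspace_eq_continuous _ _ _ f); last exact: continuous_in_subspaceT.
    move=> z /set_mem clz; have [Uz|nUz] := pselect (U z).
      by rewrite /from_subspace /sel mem_set.
    by rewrite /from_subspace /sel memNset//; apply: fg; apply: contrapT => Kz;
      apply: nUz; exact: Ucl.
  - apply: (@subspace_eq_continuous _ _ _ g); last exact: continuous_in_subspaceT.
    by move=> z /set_mem nUz; rewrite /from_subspace /sel memNset.
have ccos : continuous (fun z => cos (t z)).
  by move=> z; apply: (continuous_comp (ct z)); exact: continuous_cos.
have csin : continuous (fun z => sin (t z)).
  by move=> z; apply: (continuous_comp (ct z)); exact: continuous_sin.
pose G z := (sel gin1 gout1 z, sel gin2 gout2 z).
have cyV z : z \in closure U -> {for z, continuous (fun z => (nrm (z - y))^-1)}.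
  move=> /set_mem clz; apply: continuousV; last exact: cnr.
  by apply: nz; apply/eqP => zy; apply: ncy; rewrite -zy.
have cxV z : z \in ~` U -> {for z, continuous (fun z => (nrm (z - x))^-1)}.
  move=> /set_mem nUz; apply: continuousV; last exact: cnr.
  by apply: nz; apply/eqP => zx; apply: nUz; rewrite zx.
have cG : continuous G.
  apply: continuous_pair; apply: csel.
  - move=> w clw;
      apply: (@cvgM _ _ _ _ (fun z => cos (t z) * (z - y).1 - sin (t z) * (z - y).2)
        (fun z => (nrm (z - y))^-1)); last exact: cyV.
    by apply: cvgB; apply: cvgM; [exact: ccos|exact: cfs|exact: csin|exact: csn].
  - move=> w nUw; apply: (@cvgM _ _ _ _ (fun z => (z - x).1) (fun z => (nrm (z - x))^-1)).
      exact: cfs.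
    exact: cxV.
  - by move=> w /agree[].
  - move=> w clw;
      apply: (@cvgM _ _ _ _ (fun z => sin (t z) * (z - y).1 + cos (t z) * (z - y).2)
        (fun z => (nrm (z - y))^-1)); last exact: cyV.
    by apply: cvgD; apply: cvgM; [exact: csin|exact: cfs|exact: ccos|exact: csn].
  - move=> w nUw; apply: (@cvgM _ _ _ _ (fun z => (z - x).2) (fun z => (nrm (z - x))^-1)).
      exact: csn.
    exact: cxV.
  - by move=> w /agree[].
have G0 z : G z != 0.
  have [Uz|nUz] := pselect (U z).
    have zy : z - y != 0.
      by rewrite subr_eq0; apply: contra_notN ncy => /eqP <-; exact: subset_closure.
    have [s ps] := polar_exists zy; apply: (@polar_neq0 _ _ (t z + s)).
    move: ps => /polar_unit ey; have ny := lt0r_neq0 (nrm_gt0 zy).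
    have [ey1 ey2] : (z - y).1 = nrm (z - y) * cos s /\ (z - y).2 = nrm (z - y) * sin s.
      by split; [exact: (congr1 fst ey)|exact: (congr1 snd ey)].
    exists 1 => //; rewrite /G /sel mem_set// /gin1 /gin2 ey1 ey2 cosD sinD.
    by congr pair; field.
  have zx : z - x != 0 by rewrite subr_eq0; apply: contra_notN nUz => /eqP ->.
  have [s ps] := polar_exists zx; apply: (@polar_neq0 _ _ s).
  move: ps => /(@polar_scale _ (nrm (z - x))^-1); rewrite invr_gt0 nrm_gt0// => /(_ isT).
  by rewrite /G /sel memNset// /gout1 /gout2 !(mulrC (nrm _)^-1).
(* The cosine and the sine of an angle are not both below 1/2 in absolute value. With [N] above
   twice [M + |x|], the circle of radius [N] about [x] therefore leaves the region of norm at most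
   [M], which contains [U]. *)
pose N := 2 * (M + `|x|) + 1.
have M0 : 0 <= M by exact: le_trans xM.
have N0 : 0 < N by rewrite /N; have := normr_ge0 x; lra.
have NN : - N <= N by lra.
pose sq := `[- N, N]%classic `*` `[- N, N]%classic : set (R * R).
pose rho z := (clamp (- N) N z.1, clamp (- N) N z.2) : R * R.
have sqE (z : R * R) : sq z <-> `|z.1| <= N /\ `|z.2| <= N.
  by rewrite /sq /= !in_itv /= !ler_norml.
(* The field is lifted on the square of half-side [N] centred at [x], which contains that circle. *)
have [||||||| T cT pT] := @star_lift R (R * R)%type sq (fun w => G (x + w)) rho N.
- by apply: compact_setX; exact: segment_compact.
- by move=> z /sqE[z1 z2]; rewrite prod_normE ge_max z1.
- move=> a z /andP[a0 a1] /sqE[z1 z2]; apply/sqE; rewrite /= !normrM ger0_norm//.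
  by split; apply: le_trans (ler_wpM2r (normr_ge0 _) a1) _; rewrite mul1r.
- move=> z; apply: (@continuous_comp _ _ _ (fun w => x + w) G); last exact: cG.
  by apply: cvgD; [exact: cvg_cst|exact: cvg_id].
- by move=> z _; exact: G0.
- apply: continuous_pair => z; apply: continuous_comp; try exact: continuous_clamp.
    exact: cvg_fst.
  exact: cvg_snd.
- by move=> z; rewrite /sq /rho /= !in_itv /= !clamp_itv.
pose circ s := (N * cos s, N * sin s) : R * R.
have ccirc : continuous circ.
  apply: continuous_pair => s; apply: cvgM; try exact: cvg_cst.
    exact: continuous_cos.
  exact: continuous_sin.
have circ_sq s : `|N * cos s| <= N /\ `|N * sin s| <= N.
  rewrite !normrM (gtr0_norm N0); split; rewrite -[leRHS]mulr1 ler_pM2l// ler_norml.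
    by rewrite cos_geN1 cos_le1.
  by rewrite sin_geN1 sin_le1.
have rhoc s : rho (circ s) = circ s.
  by have [h1 h2] := circ_sq s; rewrite /rho !clampE// -ler_norml.
have big s : ~ U (x + circ s).
  move=> /UK/KM h.
  have {}h : `|circ s| <= M + `|x|.
    rewrite -(addKr x (circ s)) addrC; apply: le_trans (ler_normB _ _) _.
    by rewrite lerD2r.
  move: h; rewrite prod_normE ge_max /= !normrM (gtr0_norm N0) => /andP[h1 h2].
  have half (r : R) : N * `|r| <= M + `|x| -> `|r| < 1 / 2.
    move=> hr; rewrite ltr_pdivlMr// -(ltr_pM2l N0) mulrA;
      apply: le_lt_trans (_ : (M + `|x|) * 2 < _).
      by rewrite ler_pM2r.
    by rewrite /N; lra.
  have := cos2Dsin2 s;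
    rewrite -(real_normK (num_real (cos s))) -(real_normK (num_real (sin s))).
  move: (half _ h1) (half _ h2); have := normr_ge0 (cos s); have := normr_ge0 (sin s).
  move: `|cos s| `|sin s| => a b; nra.
have pTs s : polar (G (x + circ s)) s.
  rewrite /G /sel memNset//.
  rewrite /gout1 /gout2 addrC addKr /circ /=.
  have pc : polar (circ s) s by exists N.
  have n0 := nrm_gt0 (polar_neq0 pc).
  have -> : (N * cos s / nrm (circ s), N * sin s / nrm (circ s)) =
     ((nrm (circ s))^-1 * (circ s).1, (nrm (circ s))^-1 * (circ s).2).
    by rewrite /= !(mulrC (nrm _)^-1).
  by apply: polar_scale pc; rewrite invr_gt0.
(* Along the circle the field has angle [s], yet [T] takes the same value at both ends of the
   turn. *)
have := @circle_angle (T \o circ).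
rewrite /= /circ cos2pi sin2pi cos0 sin0 eqxx => h; apply: (negP (h _ _)) => //.
- by move=> s; apply: (continuous_comp (ccirc s)); exact: cT.
- by move=> s; have := pT (circ s); rewrite rhoc => /polar_eq; apply.
Qed.
End Plane.

Section PlaneArc.
Context {R : realType}.
Implicit Types x y z : R * R.

(** The two branches differ at the common point by a full-turn multiple; shifting one of them makes
    the union continuous and bounded on a closed set, and Tietze's theorem extends it to the
    plane. *)
Lemma polar_angle_extend (K1 K2 : set (R * R)) (h : R * R -> R * R)
    (t1 t2 : R * R -> R) p B :
  closed K1 -> closed K2 -> K1 `&` K2 `<=` [set p] ->
  {within K1, continuous t1} -> {within K2, continuous t2} ->
  (forall z, K1 z -> polar (h z) (t1 z)) ->
  (forall z, K2 z -> polar (h z) (t2 z)) ->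
  (forall z, K1 z -> `|t1 z| <= B) -> (forall z, K2 z -> `|t2 z| <= B) ->
  (K1 p -> K2 p) ->
  exists2 t : R * R -> R, continuous t & forall z, (K1 `|` K2) z -> polar (h z) (t z).
Proof.
move=> clK1 clK2 K12 ct1 ct2 pt1 pt2 B1 B2 Kp.
(* If [p] is not in [K1], the two sets are disjoint and the shift 0 will do. *)
have [c c1 cp] : exists2 c : R, cos c = 1 & (K1 p -> t1 p = t2 p + c).
  have [K1p|nK1p] := pselect (K1 p); last by exists 0; rewrite ?cos0.
  exists (t1 p - t2 p); first by apply: (@polar_eq _ (h p)); [exact: pt1|exact/pt2/Kp].
  by rewrite addrC subrK.
pose t z := if z \in K2 then t2 z + c else t1 z.
have ct : {within K1 `|` K2, continuous t}.
  apply: withinU_continuous => //.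
    apply: (@subspace_eq_continuous _ _ _ t1) => // z /set_mem K1z.
    rewrite /from_subspace /t; have [K2z|nK2z] := pselect (K2 z); last by rewrite memNset.
    have zp : z = p by apply: K12.
    by rewrite mem_set// zp cp// -zp.
  apply: (@subspace_eq_continuous _ _ _ (fun z => t2 z + c)).
    by move=> z K2z; rewrite /from_subspace /t K2z.
  by move=> z; apply: cvgD; [exact: ct2|exact: cvg_cst].
have Bt z : (K1 `|` K2) z -> `|t z| <= `|B| + `|c| + 1.
  have BB := ler_norm B; have c0 := normr_ge0 c.
  move=> K12z; rewrite /t; case: ifPn => [/set_mem/B2 b2|/negP nK2].
    by have := ler_normD (t2 z) c; lra.
  by case: K12z => [/B1|/mem_set//]; lra.
have B0 : 0 < `|B| + `|c| + 1.
  by have := normr_ge0 B; have := normr_ge0 c; lra.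
have nX : normal_space (R * R)%type by exact: (@pseudometric_normal R).
have [u [tu cu _]] := continuous_bounded_extension nX (closedU clK1 clK2) B0 ct Bt.
exists u => // z Kz; rewrite -tu ?inE// /t; case: ifPn => [/set_mem K2z|/negP nK2].
  by apply: polar_shift => //; exact: pt2.
by case: Kz => [/pt1|/mem_set].
Qed.

Lemma continuous_cdiv_sub x y :
  continuous (fun z => cdiv (z - x) (z - y)).
Proof.
have cfs a := @continuous_fst_sub R a; have csn a := @continuous_snd_sub R a.
apply: continuous_pair => z.
  by apply: cvgD; apply: cvgM; [exact: cfs|exact: cfs|exact: csn|exact: csn].
by apply: cvgB; apply: cvgM; [exact: csn|exact: cfs|exact: cfs|exact: csn].
Qed.

Lemma cdiv_neq0 w z : w != 0 -> z != 0 -> cdiv w z != 0.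
Proof.
move=> w0 z0; have [s ps] := polar_exists w0; have [t pt] := polar_exists z0.
exact: polar_neq0 (polar_cdiv ps pt).
Qed.

(** On [K] the quotient lies in the right half plane and has a continuous principal argument. On the
    arc a branch is lifted along the parameter interval and transported by the inverse of [b]. The
    two are matched at [b s], and [path_of_angle] applies to the result. *)
Lemma plane_arc_path (K : set (R * R)) (b : R -> R * R) (s t M : R) x y :
  s <= t -> closed K -> continuous b ->
  (forall u v, s <= u <= t -> s <= v <= t -> b u = b v -> u = v) ->
  (forall u, s <= u <= t -> K (b u) -> u = s) ->
  ~ K x -> ~ K y -> ~ (b @` `[s, t]) x -> ~ (b @` `[s, t]) y ->
  (forall z, ~ K z -> `|z| <= M) ->
  (forall z, K z -> 0 < (cdiv (z - x) (z - y)).1) ->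
  path_connected_in R (~` (K `|` b @` `[s, t])) x y.
Proof.
move=> st clK cb ib Kb Kx Ky bx by_ KM Kpos.
have ccd := @continuous_cdiv_sub x y.
have ts0 : 0 <= t - s by rewrite subr_ge0.
have cptA : compact `[s, t]%classic by exact: segment_compact.
have hR2 : hausdorff_space (R * R)%type by exact: norm_hausdorff.
have cptb : compact (b @` `[s, t]).
  by apply: continuous_compact => //; exact: continuous_subspaceT.
have clb : closed (b @` `[s, t]) by exact: compact_closed.
have [c cc cK] : exists2 c : R * R -> R, {within b @` `[s, t], continuous c} &
    forall u, `[s, t]%classic u -> c (b u) = u.
  by apply: arc_inverse => //; exact: continuous_subspaceT.
(* The parameter is shifted by [s] because [star_lift] contracts to the origin. *)
have [||||||| T cT pT] := @star_lift R R^o `[0, t - s]%classic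
  (fun u => cdiv (b (s + u) - x) (b (s + u) - y)) (clamp 0 (t - s)) (t - s).
- exact: segment_compact.
- by move=> u /=; rewrite in_itv /= => /andP[u0 u1]; rewrite ger0_norm.
- move=> a u /andP[a0 a1] /=; rewrite !in_itv /= => /andP[u0 u1].
  rewrite mulr_ge0//=; apply: le_trans u1.
  by rewrite -[leRHS]mul1r; exact: ler_wpM2r.
- move=> u; apply: (@continuous_comp _ _ _ (fun u => b (s + u)) (fun z => cdiv (z - x)
    (z - y))); last exact: ccd.
  apply: (@continuous_comp _ _ _ (fun u => s + u) b); last exact: cb.
  by apply: cvgD; [exact: cvg_cst|exact: cvg_id].
- move=> u /=; rewrite in_itv /= => /andP[u0 u1].
  have su : `[s, t]%classic (s + u) by rewrite /= in_itv /=; apply/andP; split; lra.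
  by apply: cdiv_neq0; rewrite subr_eq0;
    [apply: contra_notN bx|apply: contra_notN by_] => /eqP <-; exists (s + u).
- exact: continuous_clamp.
- by move=> u; rewrite /= in_itv /= clamp_itv.
have ct1 : {within K, continuous (fun z => let q := cdiv (z - x) (z - y) in atan (q.2 /
  q.1))}.
  apply: continuous_in_subspaceT => z /set_mem Kz /=.
  apply: (@continuous_comp _ _ _ (fun z => (cdiv (z - x) (z - y)).2 / (cdiv (z - x) (z
    - y)).1) atan); last exact: continuous_atan.
  apply: cvgM.
    by apply: (@continuous_comp _ _ _ (fun z => cdiv (z - x) (z - y)) snd);
      [exact: ccd|exact: cvg_snd].
  apply: cvgV; first by rewrite gt_eqF// Kpos.
  by apply: (@continuous_comp _ _ _ (fun z => cdiv (z - x) (z - y)) fst);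
    [exact: ccd|exact: cvg_fst].
have ct2 : {within b @` `[s, t], continuous (fun z => T (c z - s))}.
  move=> z; apply: (@continuous_comp (subspace (b @` `[s, t])) R R (fun z => c z - s)
    T); last exact: cT.
  by apply: cvgB; [exact: cc|exact: cvg_cst].
have [B2 B2P] : exists B, forall z, (b @` `[s, t]) z -> `|T (c z - s)| <= B.
  have := compact_bounded (continuous_compact ct2 cptb).
  case=> B [_ hB]; exists (B + 1) => z bz.
  by apply: (hB (B + 1)); [rewrite ltrDl|exists z].
have pos2 : 0 < pi / 2 :> R by rewrite divr_gt0 ?pi_gt0.
have [||||||th cth pth] := @polar_angle_extend K (b @` `[s, t]) (fun z => cdiv (z - x)
  (z - y)) _ _
  (b s) (Num.max (pi / 2) B2) clK clb _ ct1 ct2 _ _ _ _ _.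
- by move=> z [Kz [u /=]]; rewrite in_itv /= => ut bu; rewrite -bu in Kz *;
    rewrite (Kb u).
- by move=> z Kz; apply: polar_half_plane; exact: Kpos.
- move=> _ [u /= ut <-]; rewrite cK//; have := pT (u - s).
  move: ut; rewrite in_itv /= => /andP[u0 u1].
  by rewrite clampE ?subrKC//; apply/andP; split; lra.
- move=> z Kz; rewrite le_max; apply/orP; left; rewrite ler_norml /=.
  by rewrite (ltW (atan_gtNpi2 _)) (ltW (atan_ltpi2 _)).
- by move=> z bz; rewrite le_max B2P// orbT.
- by move=> _; exists s => //=; rewrite in_itv /= lexx.
apply: (path_of_angle (t := th) (M := M)) => //.
- exact: closedU.
- by case.
- by case.
- by move=> z nK; apply: KM => Kz; apply: nK; left.
Qed.

End PlaneArc.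

(** * Arcs in surfaces *)

Lemma path_connected_connected (R : realType) (X : topologicalType) (A : set X) :
  (forall x y, A x -> A y -> path_connected_in R A x y) -> connected A.
Proof.
move=> pA B [x Bx] [C oC BC] [D clD BD].
have [Ax Cx] : A x /\ C x by rewrite BC in Bx.
apply/seteqP; split=> [z|y Ay]; first by rewrite BC => -[].
have [g [cg gA g0 g1]] := pA x y Ax Ay.
have cY : connected (g @` `[0, 1]).
  by apply: connected_continuous_connected => //; exact: segment_connected.
have CD z : A z -> C z <-> D z.
  move=> Az; split=> h.
    by have : B z by [rewrite BC]; rewrite BD => -[].
  by have : B z by [rewrite BD]; rewrite BC => -[].
have h01 (u : R) : 0 <= u <= 1 -> (g @` `[0, 1]) (g u).
  by move=> ?; exists u => //=; rewrite in_itv.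
(* The relatively open and closed set [B] cuts out a nonempty clopen part of the connected path,
   hence all of it, including its end [y]. *)
have : (g @` `[0, 1]) `&` C = g @` `[0, 1].
  apply: cY.
  - by exists x; split=> //; rewrite -g0; apply: h01; rewrite lexx ler01.
  - by exists C.
  - exists D => //; apply/seteqP; split=> z [Yz h]; split=> //; apply/CD => //; exact: gA.
move=> e; rewrite BC; split=> //; rewrite -g1.
have : (g @` `[0, 1]) (g 1) by apply: h01; rewrite lexx ler01.
by rewrite -e => -[].
Qed.

Section Surface.
Context {R : realType} {S : topologicalType}.
Implicit Types (A B N : set S) (p q : S).

(** With [V] bounded, the exterior of the chart becomes a set with bounded complement, as
    [plane_arc_path] demands. *)
Definition bounded_chart (U : set S) (V : set (R * R)) (f : S -> R * R)
    (g : R * R -> S) : Prop :=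
  [/\ open U, open V, exists M, forall z, V z -> `|z| <= M,
      {within U, continuous f} /\ {within V, continuous g}
    & [/\ forall p, U p -> V (f p), forall z, V z -> U (g z),
          forall p, U p -> g (f p) = p & forall z, V z -> f (g z) = z]].

Lemma open_preimageI (X Y : topologicalType) (A : set X) (f : X -> Y) (W : set Y) :
  open A -> {within A, continuous f} -> open W -> open (A `&` f @^-1` W).
Proof.
move=> oA cf oW; move: cf; rewrite continuous_open_subspace// => cf.
by move/(continuous_inP f oA) : cf; exact.
Qed.

Lemma bounded_chart_exists p : surface R S ->
  exists U V f g, bounded_chart U V f g /\ U p.
Proof.
move=> [_ _ /(_ p)[U [V [oU Up oV [f [g [cf cg fUV gVU [fK gK]]]]]]]].
have fU q : U q -> V (f q) by move=> Uq; apply: fUV; exists q.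
have gV z : V z -> U (g z) by move=> Vz; apply: gVU; exists z.
have ob : open (ball (f p) (1 : R)) by exact: ball_open.
exists (U `&` f @^-1` ball (f p) 1), (V `&` ball (f p) 1), f, g; split.
  split.
  - exact: open_preimageI.
  - exact: openI.
  - exists (`|f p| + 1) => z [_]; rewrite -ball_normE /= => zb.
    have := ler_normB (f p) (f p - z); rewrite subKr => h; apply: le_trans h _.
    by rewrite lerD2l ltW.
  - by split; [apply: continuous_subspaceW cf|apply: continuous_subspaceW cg] => ? [].
  - split=> [q [Uq bq]|z [Vz bz]|q [Uq _]|z [Vz _]].
    + by split=> //; exact: fU.
    + by split; [exact: gV|rewrite /preimage /= gK// inE].
    + by rewrite fK// inE.
    + by rewrite gK// inE.
by split=> //; exact: ballxx.
Qed.

(** Inside the interior of an arc, a small circle of a chart would inject continuously into the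
    parameter interval. By the intermediate value theorem two antipodal points of that circle would
    share a parameter. *)
Lemma arc_interior0 (b : R -> S) s t N : surface R S -> continuous b ->
  (forall u v, s <= u <= t -> s <= v <= t -> b u = b v -> u = v) ->
  open N -> N !=set0 -> exists2 p, N p & ~ (b @` `[s, t]) p.
Proof.
move=> hS cb ib oN [p Np]; apply: contrapT => nex.
have Nb q : N q -> (b @` `[s, t]) q.
  by move=> Nq; apply: contrapT => ?; apply: nex; exists q.
have hH : hausdorff_space S by case: hS.
have [c cc cK] : exists2 c : S -> R, {within b @` `[s, t], continuous c} &
    forall u, `[s, t]%classic u -> c (b u) = u.
  apply: arc_inverse => //; first exact: segment_compact.
  exact: continuous_subspaceT.
have [U [V [f [g [[oU oV _ [cf cg] [fV gU fK gK]] Up]]]]] := bounded_chart_exists p hS.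
have oW : open (V `&` g @^-1` N) by exact: open_preimageI.
have Wfp : (V `&` g @^-1` N) (f p).
  by split; [exact: fV|rewrite /preimage /= fK].
have /nbhs_ballP[e /= e0 eW] : nbhs (f p) (V `&` g @^-1` N) by exact: open_nbhs_nbhs.
pose k (u : R) : R * R := f p + (e / 2 * cos u, e / 2 * sin u).
have e2 : 0 < e / 2 by rewrite divr_gt0.
have kW u : (V `&` g @^-1` N) (k u).
  apply: eW; rewrite -ball_normE /=.
  have -> : f p - k u = - (e / 2 * cos u, e / 2 * sin u) by rewrite /k opprD addrA
    subrr add0r.
  rewrite normrN prod_normE gt_max /= !(normrM (e / 2)) !(gtr0_norm e2).
  have lt1 (r : R) : -1 <= r -> r <= 1 -> e / 2 * `|r| < e.
    move=> r0 r1; have /(ler_wpM2l (ltW e2)) : `|r| <= 1 by rewrite ler_norml r0 r1.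
    lra.
  by rewrite !lt1 ?cos_geN1 ?cos_le1 ?sin_geN1 ?sin_le1.
have ck : continuous k.
  move=> u; apply: cvgD; first exact: cvg_cst.
  apply: (@continuous_pair _ _ (fun u => e / 2 * cos u) (fun u => e / 2 * sin u)) => v;
    apply: cvgM; try exact: cvg_cst.
    exact: continuous_cos.
  exact: continuous_sin.
pose h u := c (g (k u)).
have ch : continuous h.
  apply/continuous_subspace_setT;
    apply: (@within_comp _ _ _ _ (b @` `[s, t]) (g \o k) c) => //.
    apply: (@within_comp _ _ _ _ V k g) => //; first exact: continuous_subspaceT.
    by move=> u _; case: (kW u).
  by move=> u _; apply: Nb; case: (kW u).
have hb u : b (h u) = g (k u).
  have /Nb[v vt bv] : N (g (k u)) by case: (kW u).
  by rewrite /h -bv cK.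
(* The antipodal difference changes sign over half a turn. *)
pose d u := h u - h (u + pi).
have cd : continuous d.
  move=> u; apply: cvgB; first exact: ch.
  apply: (@continuous_comp _ _ _ (fun u => u + pi) h); last exact: ch.
  by apply: cvgD; [exact: cvg_id|exact: cvg_cst].
have dpi : d pi = - d 0.
  have kk : k (pi + pi) = k 0 by rewrite /k -mulr2n cos2pi sin2pi cos0 sin0.
  by rewrite /d /h kk add0r opprB.
have [||u _ du] := @IVT R d 0 pi 0 (pi_ge0 R).
- exact: continuous_subspaceT.
- rewrite ge_min le_max dpi; move: (d 0) => w.
  by case: (leP w 0) => ?; apply/andP; split; apply/orP; [left|right|right|left]; lra.
have /eqP : d u = 0 by [].
rewrite /d subr_eq0 => /eqP/(congr1 b); rewrite !hb => /(congr1 f).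
have [Vu _] := kW u; have [Vpi _] := kW (u + pi).
rewrite !gK// /k => /addrI[];
  rewrite cosDpi sinDpi => /(mulfI (lt0r_neq0 e2)) cu /(mulfI (lt0r_neq0 e2)) su.
have c0 : cos u = 0 by lra.
have s0 : sin u = 0 by lra.
by have := cos2Dsin2 u; rewrite c0 s0 expr0n /= addr0 => /eqP; rewrite eq_sym oner_eq0.
Qed.

Lemma chart_local_join A q : surface R S -> closed A -> ~ A q ->
  exists2 N, open_nbhs q N & forall x y, N x -> N y -> path_connected_in R (~` A) x y.
Proof.
move=> hS clA nAq.
have [U [V [f [g [[oU oV _ [cf cg] [fV gU fK gK]] Uq]]]]] := bounded_chart_exists q hS.
have oW : open (V `&` g @^-1` ~` A) by apply: open_preimageI => //; exact: closed_openC.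
have Wfq : (V `&` g @^-1` ~` A) (f q).
  by split; [exact: fV|rewrite /preimage /= fK].
have /nbhs_ballP[e /= e0 eW] : nbhs (f q) (V `&` g @^-1` ~` A) by exact: open_nbhs_nbhs.
exists (U `&` f @^-1` ball (f q) e).
  split; last by split => //; exact: ballxx.
  by apply: open_preimageI => //; exact: ball_open.
move=> x y [Ux bx] [Uy by_]; rewrite -(fK x Ux) -(fK y Uy).
apply: (@path_comp _ _ _ (ball (f q) e)).
- by apply: continuous_subspaceW cg => z /eW[].
- by move=> z /eW[].
- exact: path_ball.
Qed.

(** Both factors have the same sign and absolute value at least [7 / 8 * e]. *)
Lemma mul_far (c z x y e : R) : 0 < e -> `|c - x| < e / 8 -> `|c - y| < e / 8 ->
  e <= `|c - z| -> 49 / 64 * e ^+ 2 <= (z - x) * (z - y).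
Proof.
move=> e0; rewrite !ltr_norml ler_normr => /andP[x1 x2] /andP[y1 y2] /orP[h|h].
  have : (7 / 8 * e) * (7 / 8 * e) <= (x - z) * (y - z) by apply: ler_pM; lra.
  nra.
have : (7 / 8 * e) * (7 / 8 * e) <= (z - x) * (z - y) by apply: ler_pM; lra.
nra.
Qed.

(** A product [a * b] is a quarter of [(a + b) ^+ 2 - (a - b) ^+ 2], and here [a - b] is at most
    [e / 4] in absolute value. *)
Lemma mul_near (c z x y e : R) : `|c - x| < e / 8 -> `|c - y| < e / 8 ->
  - (1 / 64 * e ^+ 2) <= (z - x) * (z - y).
Proof.
rewrite !ltr_norml => /andP[x1 x2] /andP[y1 y2].
have : 0 <= (z - x + (z - y)) ^+ 2 by exact: sqr_ge0.
have : 0 <= (e / 4 - (x - y)) * (e / 4 + (x - y)) by apply: mulr_ge0; lra.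
nra.
Qed.

(** In the maximum norm, [z] is far from [c] in one coordinate; that coordinate contributes at least
    49/64 of [e ^+ 2], and the other one takes away at most 1/64. *)
Lemma cdiv_pos (c z x y : R * R) (e : R) : 0 < e -> ball c (e / 8) x ->
  ball c (e / 8) y -> ~ ball c e z -> 0 < (cdiv (z - x) (z - y)).1.
Proof.
move=> e0; rewrite -!ball_normE /= !prod_normE !gt_max /=.
move=> /andP[x1 x2] /andP[y1 y2] /negP; rewrite negb_and -!leNgt.
have e2 : 0 < e ^+ 2 by rewrite exprn_gt0.
have n1 := @mul_near c.1 z.1 x.1 y.1 e x1 y1.
have n2 := @mul_near c.2 z.2 x.2 y.2 e x2 y2.
case/orP => [/(mul_far e0 x1 y1)|/(mul_far e0 x2 y2)] h; rewrite /cdiv /=; lra.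
Qed.

(** Covers points [q] lying on the arc. The chart carries the situation to the plane, the radius
    [e / 8] provides the positivity of [cdiv_pos], and the planar path is carried back by [g]. *)
Lemma arc_local_join A U V f g (b : R -> S) s t q :
  hausdorff_space S -> bounded_chart U V f g -> closed A -> continuous b -> s <= t ->
  (forall u v, s <= u <= t -> s <= v <= t -> b u = b v -> u = v) ->
  (forall u, s <= u <= t -> A (b u) -> u = s) ->
  (forall u, s <= u <= t -> U (b u)) -> U q -> ~ A q ->
  exists2 N, open_nbhs q N & forall x y, N x -> N y ->
    ~ (A `|` b @` `[s, t]) x -> ~ (A `|` b @` `[s, t]) y ->
    path_connected_in R (~` (A `|` b @` `[s, t])) x y.
Proof.
move=> hH [oU oV [M VM] [cf cg] [fV gU fK gK]] clA cb st ib Ab Ub Uq nAq.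
have oW : open (V `&` g @^-1` ~` A) by apply: open_preimageI => //; exact: closed_openC.
have Wfq : (V `&` g @^-1` ~` A) (f q).
  by split; [exact: fV|rewrite /preimage /= fK].
have /nbhs_ballP[e /= e0 eW] : nbhs (f q) (V `&` g @^-1` ~` A) by exact: open_nbhs_nbhs.
exists (U `&` f @^-1` ball (f q) (e / 8)).
  split; last by split => //; apply: ballxx; rewrite divr_gt0.
  by apply: open_preimageI => //; exact: ball_open.
move=> x y [Ux bx] [Uy by_] nAx nAy.
have xK : g (f x) = x by exact: fK.
have yK : g (f y) = y by exact: fK.
rewrite -xK -yK.
(* Everything outside [V] is put into [K], so [K] has bounded complement and a path avoiding it
   stays in the chart. *)
pose K := ~` (V `&` g @^-1` ~` A).
pose b' u := f (b (clamp s t u)).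
have b'E u : s <= u <= t -> b' u = f (b u) by move=> ut; rewrite /b' clampE.
have cb' : continuous b'.
  apply/continuous_subspace_setT;
    apply: (@within_comp _ _ _ _ U (b \o clamp s t) f) => //.
    apply: continuous_subspaceT => u.
    by apply: continuous_comp; [exact: continuous_clamp|exact: cb].
  by move=> u _; apply: Ub; exact: clamp_itv.
have nb' z : U z -> ~ (A `|` b @` `[s, t]) z -> ~ (b' @` `[s, t]) (f z).
  move=> Uz nz [u /= ut]; rewrite b'E; last by move: ut; rewrite in_itv.
  move=> bu; apply: nz; right; exists u => //.
  by rewrite -(fK z Uz) -bu fK//; apply: Ub; move: ut; rewrite in_itv.
have nK z : U z -> ~ (A `|` b @` `[s, t]) z -> ~ K (f z).
  move=> Uz nz; apply; split; first exact: fV.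
  by rewrite /preimage /= fK// => Az; apply: nz; left.
have pR2 : path_connected_in R (~` (K `|` b' @` `[s, t])) (f x) (f y).
  apply: (@plane_arc_path _ K b' s t M) => //.
  - exact: open_closedC.
  - move=> u v ut vt; rewrite !b'E// => /(congr1 g); rewrite !fK; try exact: Ub.
    exact: ib.
  - move=> u ut; rewrite b'E// => Ku; apply: Ab => //; apply: contrapT => nAu; apply: Ku.
    by split; [exact/fV/Ub|rewrite /preimage /= fK//; exact: Ub].
  - exact: nK.
  - exact: nK.
  - exact: nb'.
  - exact: nb'.
  - by move=> z /contrapT[Vz _]; exact: VM.
  - move=> z Kz; have : ~ ball (f q) e z by move=> /eW.
    exact: cdiv_pos.
apply: path_comp pR2; first by apply: continuous_subspaceW cg => z nz;
  apply: contrapT => nVz; apply: nz; left; case.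
move=> z nz [Az|[u /= ut bu]].
  by apply: nz; left => -[].
apply: nz; have [Vz|nVz] := pselect (V z); last by left => -[].
right; exists u => //; rewrite b'E ?bu ?gK//.
Qed.

(** Fix [x] off the larger set. Near a point of the complement of [A], the points off the larger set
    are either all reachable from [x] or all unreachable. Both alternatives are open, and they
    exclude each other because an arc has empty interior; connectedness of the complement of [A]
    leaves only the first. *)
Lemma small_arc_complement A U V f g (b : R -> S) s t :
  surface R S -> bounded_chart U V f g -> closed A -> connected (~` A) ->
  continuous b -> s <= t ->
  (forall u v, s <= u <= t -> s <= v <= t -> b u = b v -> u = v) ->
  (forall u, s <= u <= t -> A (b u) -> u = s) ->
  (forall u, s <= u <= t -> U (b u)) ->
  connected (~` (A `|` b @` `[s, t])) /\
  forall x y, ~ (A `|` b @` `[s, t]) x -> ~ (A `|` b @` `[s, t]) y ->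
    path_connected_in R (~` (A `|` b @` `[s, t])) x y.
Proof.
move=> hS hc clA cA cb st ib Ab Ub.
have hH : hausdorff_space S by case: hS.
have cptb : compact (b @` `[s, t]).
  by apply: continuous_compact; [exact: continuous_subspaceT|exact: segment_compact].
have clb : closed (b @` `[s, t]) by exact: compact_closed.
have clAb := closedU clA clb.
set A' := A `|` _ in clAb *.
suff pA' : forall x y, ~ A' x -> ~ A' y -> path_connected_in R (~` A') x y.
  by split=> //; exact: path_connected_connected pA'.
have local q : ~ A q -> exists2 N, open_nbhs q N & forall x y, N x -> N y ->
    ~ A' x -> ~ A' y -> path_connected_in R (~` A') x y.
  move=> nAq; have [[u ut bu]|nbq] := pselect ((b @` `[s, t]) q).
    apply: (arc_local_join hH hc clA cb st ib Ab Ub) => //.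
    by rewrite -bu; apply: Ub; move: ut; rewrite /= in_itv.
  have nA'q : ~ A' q by case.
  have [N oN NA] := chart_local_join hS clAb nA'q.
  by exists N => // x y Nx Ny _ _; exact: NA.
move=> x y nx ny.
pose W := path_component R (~` A') x.
pose E := [set q | exists2 N, open_nbhs q N & N `&` ~` A' `<=` W].
pose F := [set q | exists2 N, open_nbhs q N & N `&` ~` A' `<=` ~` W].
have oE : open E.
  rewrite openE => q [N [oN Nq] NW]; apply: filterS (open_nbhs_nbhs (conj oN Nq)) => p Np.
  by exists N.
have oF : open F.
  rewrite openE => q [N [oN Nq] NW]; apply: filterS (open_nbhs_nbhs (conj oN Nq)) => p Np.
  by exists N.
have EF q : ~ A q -> E q -> ~ F q.
  move=> nAq [N [oN Nq] NW] [N' [oN' N'q] NW'].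
  have [||p [[Np N'p] nAp] nbp] := @arc_interior0 b s t (N `&` N' `&` ~` A) hS cb ib.
  - by apply: openI; [exact: openI|exact: closed_openC].
  - by exists q.
  have nA'p : ~ A' p by case.
  by apply: (NW' p) => //; exact: NW.
have EorF q : ~ A q -> E q \/ F q.
  move=> nAq; have [N oN NA] := local _ nAq.
  have [[p [Np nAp Wp]]|nex] := pselect (exists p, [/\ N p, ~ A' p & W p]).
    left; exists N => // z [Nz nAz]; apply: path_trans Wp _; exact: NA.
  by right; exists N => // z [Nz nAz] Wz; apply: nex; exists z.
have nAx : ~ A x by move=> ?; apply: nx; left.
have nAy : ~ A y by move=> ?; apply: ny; left.
have Wx : W x by exact: path_refl.
have Ex : E x.
  have [//|[N [_ Nx] NW]] := EorF x nAx.
  by have := NW x (conj Nx nx).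
have : ~` A `&` E = ~` A.
  apply: cA; first by exists x.
    by exists E.
  exists (~` F); first exact: open_closedC.
  apply/seteqP; split=> q [nAq h]; split=> //; first exact: EF.
  by case: (EorF q nAq).
move=> /seteqP[_ /(_ y nAy)[_ [N [_ Ny] NW]]].
by apply: NW.
Qed.

(** A Lebesgue number cuts the arc into subarcs lying in charts. Connectedness of the complement
    feeds the next step of the induction; joining by paths is what the face count uses. *)
Lemma arc_complement A (b : R -> S) T :
  surface R S -> closed A -> connected (~` A) ->
  continuous b -> 0 <= T ->
  (forall u v, 0 <= u <= T -> 0 <= v <= T -> b u = b v -> u = v) ->
  (forall u, 0 <= u <= T -> A (b u) -> u = 0) ->
  connected (~` (A `|` b @` `[0, T])) /\
  forall x y, ~ (A `|` b @` `[0, T]) x -> ~ (A `|` b @` `[0, T]) y ->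
    path_connected_in R (~` (A `|` b @` `[0, T])) x y.
Proof.
move=> hS clA cA cb T0 ib Ab.
have hH : hausdorff_space S by case: hS.
pose Q (B : set R) := exists U V f g, bounded_chart U V f g /\ b @` B `<=` U.
have [||d d0 dQ] := @lebesgue_number R R `[0, T]%classic Q (@segment_compact R 0 T).
- move=> B B' BB' [U [V [f [g [hc bU]]]]]; exists U, V, f, g; split=> //.
  by apply: subset_trans bU; exact: image_subset.
- move=> u _; have [U [V [f [g [hc Ubu]]]]] := bounded_chart_exists (b u) hS.
  exists (b @^-1` U); last by exists U, V, f, g; split=> // _ [v Uv <-].
  by apply: cb; apply: open_nbhs_nbhs; split=> //; case: hc.
pose P t := connected (~` (A `|` b @` `[0, t])) /\
  forall x y, ~ (A `|` b @` `[0, t]) x -> ~ (A `|` b @` `[0, t]) y ->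
    path_connected_in R (~` (A `|` b @` `[0, t])) x y.
have cpt s t : compact (b @` `[s, t]).
  by apply: continuous_compact; [exact: continuous_subspaceT|exact: segment_compact].
(* The induction starts from the one-point arc, for which injectivity and the meeting condition are
   trivial. *)
have P0 : P 0.
  have [U [V [f [g [hc Ubu]]]]] := bounded_chart_exists (b 0) hS.
  have e0 (u : R) : 0 <= u <= 0 -> u = 0 by move=> ?; apply/eqP; rewrite eq_le andbC.
  apply: (small_arc_complement hS hc clA cA cb (lexx 0)).
  - by move=> u v /e0-> /e0->.
  - by move=> u /e0.
  - by move=> u /e0->.
have Pstep s t : 0 <= s -> s <= t -> t <= T -> t < s + d -> P s -> P t.
  move=> s0 st tT td [cs _].
  have sT : `[0, T]%classic s by rewrite /= in_itv /= s0 (le_trans st).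
  have [U [V [f [g [hc bU]]]]] := dQ s sT.
  have cls : closed (A `|` b @` `[0, s]) by apply: closedU => //; exact: compact_closed.
  have -> : P t = (connected (~` ((A `|` b @` `[0, s]) `|` b @` `[s, t])) /\
    forall x y, ~ ((A `|` b @` `[0, s]) `|` b @` `[s, t]) x -> ~ ((A `|` b @` `[0, s])
      `|` b @` `[s, t]) y ->
    path_connected_in R (~` ((A `|` b @` `[0, s]) `|` b @` `[s, t])) x y).
    have e : `[0, t]%classic = `[0, s]%classic `|` `[s, t]%classic :> set R.
      apply/seteqP; split=> u /=; rewrite !in_itv /=.
        by move=> /andP[u0 ut]; case: (leP u s) => [us|/ltW us]; [left|right]; apply/andP.
      by case=> /andP[u0 us]; apply/andP; split; lra.
    by rewrite -setUA -image_setU -e.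
  apply: (small_arc_complement hS hc cls cs cb st).
  - by move=> u v /andP[us ut] /andP[vs vt]; apply: ib; apply/andP; split; lra.
  - move=> u /andP[us ut] [/Ab h|[v /=]].
      by apply/eqP; rewrite eq_le us andbT h//; apply/andP; split; lra.
    rewrite in_itv /= => /andP[v0 vs] /ib vu; apply/eqP; rewrite eq_le us andbT -vu//;
      apply/andP; split; lra.
  - move=> u /andP[us ut]; apply: bU; exists u => //.
    by rewrite -ball_normE /= ler0_norm; lra.
(* Advancing by [d / 2] keeps each subarc within the Lebesgue radius; the minimum with [T] shortens
   the last one, and [N] steps reach [T]. *)
pose N := (Num.trunc (T / (d / 2))).+1.
have Pk k : P (Num.min T (k%:R * (d / 2))).
  elim: k => [|k IH]; first by rewrite mul0r min_r.
  have kd : k%:R * (d / 2) <= k.+1%:R * (d / 2) by rewrite ler_wpM2r ?ler_nat//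
    divr_ge0// ltW.
  apply: Pstep IH.
  - by rewrite le_min T0 mulr_ge0// divr_ge0// ltW.
  - by rewrite le_min !ge_min lexx /= kd orbT.
  - by rewrite ge_min lexx.
  - move: kd; rewrite -(natr1 k) mulrDl mul1r; move: (k%:R * (d / 2)) => w wd.
    by rewrite gt_min; case: (leP T w) => h; apply/orP; [left|right]; lra.
have := Pk N; rewrite min_l//.
have d2 : 0 < d / 2 by rewrite divr_gt0.
by rewrite -ler_pdivrMr//; exact/ltW/truncnS_gt.
Qed.
End Surface.

(** * Arcs in the realization of a cycle *)

Section Edges.
Context {R : realType} {G : graph}.
Implicit Types (e : edge G) (v : vert G) (t u : R).

Lemma realization_pi_eq (x y : cells R G) :
  realization_pi x = realization_pi y <-> glue_ends x = glue_ends y.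
Proof.
rewrite /realization_pi; split.
  by move=> /eqmodP/eqP.
by move=> h; apply/eqmodP/eqP.
Qed.

Lemma clamp01_mem t : clamp 0 1 t \in (`[0, 1]%classic : set R).
Proof. by apply: mem_set; rewrite /= in_itv /= clamp_itv. Qed.

(** Clamping lets an edge be parametrized by the whole line, as [arc_complement] expects. *)
Definition to01 t : set_type (`[0, 1]%classic : set R) :=
  exist (fun u => u \in (`[0, 1]%classic : set R)) (clamp 0 1 t) (clamp01_mem t).

Lemma to01E t : 0 <= t <= 1 -> set_val (to01 t) = t.
Proof. by move=> t01; exact: clampE. Qed.

Definition edge_arc e t : realization R G := realization_pi (edge_pt e (to01 t)).

Definition vertex_point v : realization R G := realization_pi (@vertex_pt R G v).

Lemma continuous_edge_arc e : continuous (edge_arc e).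
Proof.
move=> t; apply: (@continuous_comp _ _ _ (fun t => edge_pt e (to01 t)) (@realization_pi
  R G)); last first.
  exact: pi_continuous.
apply: (@continuous_comp R (@cell R G (inr e)) (cells R G) to01 (existT (fun c => cell
  R c) (inr e))); last first.
  exact: existT_continuous.
apply: (@continuous_comp_initial _ _ _ set_val to01).
exact: continuous_clamp.
Qed.

Lemma glue_edge e t : 0 <= t <= 1 ->
  glue_ends (edge_pt e (to01 t)) =
    if t == 0 then @vertex_pt R G (src e) else if t == 1 then vertex_pt R (tgt e)
    else edge_pt e (to01 t).
Proof. by move=> t01; rewrite /edge_pt /= to01E. Qed.

Lemma edge_arc0 e : edge_arc e 0 = vertex_point (src e).
Proof. by apply/realization_pi_eq; rewrite glue_edge ?eqxx ?lexx ?ler01. Qed.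

Lemma edge_arc1 e : edge_arc e 1 = vertex_point (tgt e).
Proof. by apply/realization_pi_eq; rewrite glue_edge ?oner_eq0 ?eqxx ?lexx ?ler01. Qed.

(** Extracts the parameter without comparing dependent components; the value 0 at vertices is a
    default. *)
Definition coordinate (x : cells R G) : R :=
  match x with
  | existT (inl _) _ => 0
  | existT (inr _) t => set_val t
  end.

Lemma edge_pt_eq e e' t t' : 0 <= t <= 1 -> 0 <= t' <= 1 ->
  edge_pt e (to01 t) = edge_pt e' (to01 t') -> e = e' /\ t = t'.
Proof.
move=> t01 t'01 h; split; first by have [] := congr1 (@projT1 _ _) h.
by have := congr1 coordinate h; rewrite /= !to01E.
Qed.

Lemma edge_arc_vertex e v t : 0 <= t <= 1 -> edge_arc e t = vertex_point v ->
  (t = 0 /\ src e = v) \/ (t = 1 /\ tgt e = v).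
Proof.
move=> t01 /realization_pi_eq; rewrite glue_edge//.
case: eqP => [-> h|_]; first by left; split=> //; have [] := congr1 (@projT1 _ _) h.
case: eqP => [-> h|_]; first by right; split=> //; have [] := congr1 (@projT1 _ _) h.
by move=> h; have := congr1 (@projT1 _ _) h.
Qed.

(** A point of [e'] with parameter other than 0 and 1 is fixed by [glue_ends], so it lies on no
    other edge. *)
Lemma edge_arc_meet e e' t t' : 0 <= t <= 1 -> 0 <= t' <= 1 -> e != e' ->
  edge_arc e t = edge_arc e' t' ->
  exists2 v, edge_arc e t = vertex_point v & v = src e' \/ v = tgt e'.
Proof.
move=> t01 t'01 ee h.
have [t0|t0] := eqVneq t' 0; first by exists (src e'); rewrite ?h ?t0 ?edge_arc0//; left.
have [t1|t1] := eqVneq t' 1; first by exists (tgt e'); rewrite ?h ?t1 ?edge_arc1//; right.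
move: h => /realization_pi_eq; rewrite !glue_edge// (negbTE t0) (negbTE t1).
case: eqP => [_ h|_]; first by have := congr1 (@projT1 _ _) h.
case: eqP => [_ h|_]; first by have := congr1 (@projT1 _ _) h.
by move=> /(edge_pt_eq t01 t'01)[/eqP]; rewrite (negbTE ee).
Qed.

(** Gluing can only identify the two ends, which is excluded because the edge is not a loop. *)
Lemma edge_arc_inj e t t' : src e != tgt e -> 0 <= t <= 1 -> 0 <= t' <= 1 ->
  edge_arc e t = edge_arc e t' -> t = t'.
Proof.
move=> st t01 t'01 h.
have st' : src e <> tgt e by exact/eqP.
have [t0|t0] := eqVneq t' 0.
  by move: h; rewrite t0 edge_arc0 => /(edge_arc_vertex t01)[[]//|[_ /esym]].
have [t1|t1] := eqVneq t' 1.
  by move: h; rewrite t1 edge_arc1 => /(edge_arc_vertex t01)[[]//|[]].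
move: h => /realization_pi_eq; rewrite !glue_edge// (negbTE t0) (negbTE t1).
case: eqP => [_ h|_]; first by have := congr1 (@projT1 _ _) h.
case: eqP => [_ h|_]; first by have := congr1 (@projT1 _ _) h.
by move=> /(edge_pt_eq t01 t'01)[].
Qed.

Lemma sub_realizationE (H : subgraph G) (p : realization R G) :
  sub_realization H p <->
  (exists2 v, v \in sub_vert H & p = vertex_point v) \/
  (exists e t, [/\ e \in sub_edge H, 0 <= t <= 1 & p = edge_arc e t]).
Proof.
split.
  move=> [[[v|e] /= t] Ht <-].
    by left; exists v => //; case: t.
  right; exists e, (set_val t); split=> //.
    by have := set_mem (valP t); rewrite /= in_itv.
  congr realization_pi; congr existT; apply: val_inj => /=; rewrite clampE//.
  by have := set_mem (valP t); rewrite /= in_itv.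
move=> [[v vH ->]|[e [t [eH _ ->]]]].
  by exists (@vertex_pt R G v).
by exists (edge_pt e (to01 t)).
Qed.

End Edges.

Section CycleArc.
Context {R : realType} (n : nat).
Implicit Types (a : 'I_n) (l : nat).

Definition cshift j a : 'I_n := iter j (@ordS n) a.

Lemma cshift_val j a : cshift j a = ((a + j) %% n)%N :> nat.
Proof.
elim: j => [|j IH] /=; first by rewrite addn0 modn_small.
by rewrite IH -addn1 modnDml addn1 addnS.
Qed.

Lemma cshift_eq j j' a : (j < n)%N -> (j' < n)%N ->
  cshift j a = cshift j' a -> j = j'.
Proof.
move=> jn j'n /(congr1 val); rewrite /= !cshift_val => /eqP.
by rewrite eqn_modDl !modn_small// => /eqP.
Qed.

(** The [l] consecutive edges starting at [a]; listing [a] separately makes the case [l = 0] a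
    single point. *)
Definition cycle_arc a l : set (realization R (cycle_graph n)) :=
  [set p | p = @vertex_point R (cycle_graph n) a \/
    exists j t, [/\ (j < l)%N, 0 <= t <= 1
                  & p = @edge_arc R (cycle_graph n) (cshift j a) t]].

(** Writes a vertex as a degenerate subarc of an edge, so that the base case below is also an
    application of [arc_complement]. *)
Lemma cycle_arc0 a : cycle_arc a 0 = @edge_arc R (cycle_graph n) a @` `[0, 0].
Proof.
apply/seteqP; split=> p.
  move=> [->|[j [t []]]//]; exists 0; first by rewrite /= in_itv /= lexx.
  by rewrite edge_arc0.
move=> [t /=]; rewrite in_itv /= -eq_le => /eqP <- <-; left.
by rewrite edge_arc0.
Qed.

Lemma cycle_arcS a l : cycle_arc a l.+1 =
  cycle_arc a l `|` @edge_arc R (cycle_graph n) (cshift l a) @` `[0, 1].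
Proof.
apply/seteqP; split=> p.
  move=> [->|[j [t [jl t01 ->]]]]; first by left; left.
  move: jl; rewrite ltnS leq_eqVlt => /orP[/eqP->|jl].
    by right; exists t => //=; rewrite in_itv.
  by left; right; exists j, t.
move=> [[->|[j [t [jl t01 ->]]]]|[t /=]]; first by left.
  by right; exists j, t; split=> //; exact: ltnW.
by rewrite in_itv /= => t01 <-; right; exists l, t.
Qed.

(** Two edges meet only in vertices, and as [l.+1 < n] the far end of the new edge has not come
    round to a vertex already visited. *)
Lemma cycle_arc_meet a l t : (l.+1 < n)%N -> 0 <= t <= 1 ->
  cycle_arc a l (@edge_arc R (cycle_graph n) (cshift l a) t) -> t = 0.
Proof.
move=> ln t01 h.
have [j jl ej] : exists2 j, (j <= l)%N &
    @edge_arc R (cycle_graph n) (cshift l a) t = vertex_point (cshift j a : vert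
      (cycle_graph n)).
  case: h => [h|[j [u [jl u01 h]]]]; first by exists 0%N.
  have ne : cshift l a != cshift j a.
    apply/eqP => /cshift_eq e; have lj : l = j by apply: e; lia.
    by move: jl; rewrite lj ltnn.
  have [v ev] := @edge_arc_meet R (cycle_graph n) _ _ _ _ t01 u01 ne h.
  by case=> vE; [exists j|exists j.+1]; rewrite ?ev ?vE//; exact: ltnW.
case: (edge_arc_vertex t01 ej) => [[]//|[_ e]].
have lj : l.+1 = j by apply: (@cshift_eq l.+1 j a _ _ e); lia.
by move: jl; rewrite -lj ltnn.
Qed.

End CycleArc.

Section Faces.
Context {R : realType} {S : topologicalType} (n : nat) (n1 : (1 < n)%N).
Context (sigma : realization R (cycle_graph n) -> S).
Context (hS : surface R S) (hconn : connected (setT : set S)).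
Context (hsigma : embedding sigma).

(** Edges are added one at a time, each meeting the previous ones only in its initial vertex. The
    complement stays nonempty because an arc has empty interior. *)
Lemma cycle_arc_complement (a : 'I_n) l : (l < n)%N ->
  [/\ closed (sigma @` cycle_arc a l), (~` (sigma @` cycle_arc a l)) !=set0,
      connected (~` (sigma @` cycle_arc a l)) &
      forall x y, ~ (sigma @` cycle_arc a l) x -> ~ (sigma @` cycle_arc a l) y ->
        path_connected_in R (~` (sigma @` cycle_arc a l)) x y].
Proof.
have [isig csig _] := hsigma.
have hH : hausdorff_space S by case: hS.
pose b (e : 'I_n) t := sigma (@edge_arc R (cycle_graph n) e t).
have cb e : continuous (b e).
  move=> t; apply: (@continuous_comp _ _ _ (@edge_arc R (cycle_graph n) e) sigma);
    last exact: csig.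
  exact: continuous_edge_arc.
have ib e t u : 0 <= t <= 1 -> 0 <= u <= 1 -> b e t = b e u -> t = u.
  move=> t01 u01 /isig; apply: edge_arc_inj => //=.
  apply/eqP => /(congr1 val) /= h.
  have := @cshift_eq n 0 1 e; rewrite /cshift /=.
  move=> /(_ (ltnW n1) n1) H; suff : 0%N = 1%N by []; apply: H.
  exact: val_inj.
have bE e s t : sigma @` (@edge_arc R (cycle_graph n) e @` `[s, t]) = b e @` `[s, t].
  by rewrite image_comp.
have cpt e (s t : R) : closed (b e @` `[s, t]).
  apply: compact_closed => //; apply: continuous_compact; last exact: segment_compact.
  exact: continuous_subspaceT.
have extend (A : set S) e T : closed A -> ~` A !=set0 -> connected (~` A) -> 0 <= T <=
  1 ->
    (forall u, 0 <= u <= T -> A (b e u) -> u = 0) ->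
    let B := A `|` b e @` `[0, T] in
  [/\ closed B, ~` B !=set0, connected (~` B) &
      forall x y, ~ B x -> ~ B y -> path_connected_in R (~` B) x y].
  move=> clA nA cA /andP[T0 T1] Ab B.
  have ib' u v : 0 <= u <= T -> 0 <= v <= T -> b e u = b e v -> u = v.
    by move=> /andP[u0 uT] /andP[v0 vT]; apply: ib; rewrite ?u0 ?v0 /=;
      exact: le_trans T1.
  have [cB pB] := arc_complement hS clA cA (cb e) T0 ib' Ab.
  split=> //; first exact: closedU.
  have [p nAp nbp] := arc_interior0 hS (cb e) ib' (closed_openC clA) nA.
  by exists p; case.
elim: l => [_|l IH ln].
  (* A vertex is added to the empty set, whose complement is the connected surface itself. *)
  rewrite cycle_arc0 bE -[b a @` _]set0U; apply: extend.
  - exact: closed0.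
  - by exists (b a 0).
  - by rewrite setC0.
  - by rewrite lexx ler01.
  - by [].
have [clA nA cA _] := IH (ltnW ln).
rewrite cycle_arcS image_setU bE; apply: extend => //.
  by rewrite lexx ler01.
move=> u u01 [p Ap /isig pE]; apply: (@cycle_arc_meet R n a l u) => //.
by rewrite -pE.
Qed.

(** The complement is nonempty and any two of its points are joined by a path, so it is its own
    unique path component. *)
Lemma faces_cycle_arc (K : subgraph (cycle_graph n)) (a : 'I_n) l : (l < n)%N ->
  sub_realization K = @cycle_arc R n a l -> faces_connected sigma K = 1%E.
Proof.
move=> ln KE; have [_ [p np] _ pA] := @cycle_arc_complement a l ln.
rewrite /faces_connected KE (_ : path_components _ _ = [set ~` (sigma @` cycle_arc a l)]).
  rewrite /counting asboolT; last exact: finite_set1.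
  by rewrite fset_set1 finmap.cardfs1.
apply/seteqP; split=> [_ [x nx <-]|_ ->].
  apply/seteqP; split=> y; last exact: pA.
  by move=> [g [_ gA _ <-]]; apply: gA; exists 1 => //=; rewrite in_itv /= ler01 lexx.
exists p => //; apply/seteqP; split=> y; last exact: pA.
by move=> [g [_ gA _ <-]]; apply: gA; exists 1 => //=; rewrite in_itv /= ler01 lexx.
Qed.

End Faces.

(** * Components of induced subgraphs of a cycle *)

Section Runs.
Context {R : realType} (n : nat).
Local Notation C := (cycle_graph n).
Implicit Types (i a u v w : 'I_n) (W : {set 'I_n}).

(** The last vertices of the cyclic runs of [W]; for proper [W] each run has exactly one, so they
    label the components. *)
Definition right_ends W : {set 'I_n} := [set i in W | ordS i \notin W]%SET.

Lemma cshiftD j k a : cshift j (cshift k a) = cshift (j + k) a.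
Proof. by rewrite /cshift iterD. Qed.

Lemma cshift_full a : cshift n a = a.
Proof. by apply: val_inj; rewrite /= cshift_val modnDr modn_small. Qed.

Lemma cshift_between a u : exists2 j, (j < n)%N & cshift j a = u.
Proof.
have n0 : (0 < n)%N by case: (n) a => [[]|].
exists ((u + (n - a)) %% n)%N; first by rewrite ltn_mod.
apply: val_inj; rewrite /= cshift_val modnDmr addnCA subnKC; last exact: ltnW.
by rewrite modnDr modn_small.
Qed.

Lemma induced_edge (H : subgraph C) (e : 'I_n) : is_induced H ->
  ((e : edge C) \in sub_edge H) =
  ((e : vert C) \in sub_vert H) && ((ordS e : vert C) \in sub_vert H).
Proof.
move=> /forallP/(_ e)/implyP h1; apply/idP/idP => //.
by have /forall_inP := sub_subgraph H; apply.
Qed.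

Lemma adj_sym (H : subgraph C) : connect_sym (adj H).
Proof.
apply: sym_connect_sym => u v; apply/eq_existsb => e.
by rewrite orbC.
Qed.

(* Positions are counted cyclically from a missing vertex [w]; [p] and [q] are
   the missing positions on either side of the run of [v]. *)
Lemma component_run (H : subgraph C) (v : 'I_n) : is_induced H ->
  (v : vert C) \in sub_vert H -> (#|sub_vert H| < n)%N ->
  exists w p q, [/\ (p.+1 < q <= n)%N,
    forall u : 'I_n, connect (adj H) v u <->
      exists2 j, (p < j < q)%N & u = cshift j w,
    (cshift q w : vert C) \notin sub_vert H &
    forall j, (p < j < q)%N -> (cshift j w : vert C) \in sub_vert H].
Proof.
move=> Hi vH Hn.
have [w nw] : exists w : 'I_n, (w : vert C) \notin sub_vert H.
  apply/existsP; rewrite -negb_forall; apply: contraL Hn => /forallP h.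
  rewrite -leqNgt -[leqLHS]card_ord; apply: subset_leq_card.
  by apply/fintype.subsetP => u _; exact: h.
pose mem j := (cshift j w : vert C) \in sub_vert H.
have [i i_n iv] := cshift_between w v.
have mi : mem i by rewrite /mem iv.
have m0 : ~~ mem 0%N by [].
have mn : ~~ mem n by rewrite /mem cshift_full.
have i0 : (0 < i)%N by case: (i) mi m0 => // ->.
(* Positions 0 and [n] both denote the missing vertex [w], so there is a missing position on either
   side of [v]. *)
have exp : exists p, (p < i)%N && ~~ mem p by exists 0%N; rewrite i0.
have exq : exists q, (i < q)%N && ~~ mem q by exists n; rewrite i_n.
have [p /andP[pi mp] pmax] := @ex_maxnP _ i exp (fun j h => ltnW (proj1 (andP h))).
have [q /andP[iq mq] qmin] := ex_minnP exq.
have qn : (q <= n)%N by apply: qmin; rewrite i_n.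
have run j : (p < j < q)%N -> mem j.
  move=> /andP[pj jq]; apply: contraT => mj.
  have [ji|ij|ji] := ltngtP j i.
  - by have := pmax j; rewrite ji mj => /(_ isT); rewrite leqNgt pj.
  - by have := qmin j; rewrite ij mj => /(_ isT); rewrite leqNgt jq.
  - by rewrite ji mi in mj.
have pq : (p.+1 < q)%N by exact: leq_ltn_trans iq.
exists w, p, q; split=> //; first by rewrite pq.
have step j : (p < j)%N -> (j.+1 < q)%N -> connect (adj H) (cshift j w) (cshift j.+1 w).
  move=> pj jq; apply: connect1; apply/exists_inP; exists (cshift j w : edge C).
    by rewrite induced_edge//; apply/andP; split; [apply: (run j)|apply: (run j.+1)]; lia.
  by rewrite !eqxx.
have fromp j : (p < j < q)%N -> connect (adj H) (cshift p.+1 w) (cshift j w).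
  elim: j => [//|j IH] /andP[]; rewrite ltnS leq_eqVlt => /orP[/eqP->//|pj] jq.
  by apply: connect_trans (IH _) (step _ pj jq); rewrite pj ltnW.
move=> u; split.
  have : exists2 j, (p < j < q)%N & v = cshift j w by exists i; rewrite ?pi.
  (* An edge changes the position by one, and it cannot reach [p] or [q] since both its ends lie in
     [H]. *)
  move=> + /connectP[s];
    elim: s v {vH iv} => [v h _ -> //|u' s IH v [j /andP[pj jq] vE] /= /andP[vu' su'] uE].
  apply: IH su' uE; move: vu' => /exists_inP[e]; rewrite induced_edge// => /andP[eH eH'].
  move=> /orP[] /andP[/eqP e1 /eqP e2].
    have uE : u' = cshift j.+1 w by rewrite -e2 -e1 /= in vE *; rewrite /= vE.
    have jq' : j.+1 != q.
      apply: contraTneq eH' => jq'; rewrite -jq' /mem in mq.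
      by move: e2; rewrite /= => ->; rewrite uE.
    exists j.+1 => //; lia.
  have j0 : (0 < j)%N by exact: leq_ltn_trans pj.
  have uE : u' = cshift j.-1 w.
    rewrite -e1; apply: (bij_inj (@ordS_bij n)); move: e2 => /= ->.
    by rewrite vE -{1}(prednK j0).
  have pj' : p != j.-1.
    apply: contraTneq eH => pj'; rewrite pj' /mem -uE in mp.
    by move: e1; rewrite /= => ->.
  exists j.-1 => //; lia.
move=> [j pjq ->]; apply: connect_trans (fromp j pjq).
by rewrite adj_sym -iv; apply: fromp; rewrite pi.
Qed.

Lemma component_cycle_arc (H : subgraph C) (v : 'I_n) : is_induced H ->
  (v : vert C) \in sub_vert H -> (#|sub_vert H| < n)%N ->
  exists a l, (l < n)%N /\
    sub_realization (component H v) = @cycle_arc R n a l.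
Proof.
move=> Hi vH Hn; have [w [p [q [/andP[pq qn] vc nq run]]]] := component_run Hi vH Hn.
(* The run occupies the positions from [p + 1] to [q - 1], hence has [q - p - 2] edges. *)
exists (cshift p.+1 w), (q - p.+2)%N; split; first lia.
apply/seteqP; split=> z.
  move=> /sub_realizationE[[u]|[e [t []]]].
    rewrite inE => /vc[j /andP[pj jq] ->] ->.
    have [->|jp] := eqVneq j p.+1; first by left.
    (* A vertex other than the first is the far end of the edge before it. *)
    right; exists (j - p.+2)%N, 1; split; rewrite ?lexx ?ler01//; first lia.
    rewrite edge_arc1 cshiftD; congr vertex_point.
    by rewrite -[RHS]/(cshift (j - p.+2 + p.+1).+1 w); congr cshift; lia.
  rewrite inE => /andP[eH /vc[j /andP[pj jq] eE]] t01 ->.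
  have {}eE : e = cshift j w :> 'I_n by exact: eE.
  move: eH; rewrite induced_edge// eE => /andP[_ eH].
  have jq' : (j.+1 < q)%N.
    rewrite ltn_neqAle jq andbT; apply: contraTneq eH => jE.
    by rewrite -jE in nq.
  right; exists (j - p.+1)%N, t; split=> //; first lia.
  by rewrite cshiftD; congr edge_arc; congr cshift; lia.
move=> [->|[j [t [jl t01 ->]]]]; apply/sub_realizationE.
  left; exists (cshift p.+1 w) => //; rewrite inE; apply/vc; exists p.+1 => //.
  by rewrite ltnS leqnn.
right; exists (cshift j (cshift p.+1 w)), t; split=> //; rewrite cshiftD inE.
rewrite induced_edge//; apply/andP; split.
  apply/andP; split; first by apply: run; lia.
  by apply: (run (j + p.+1).+1); lia.
by apply/vc; exists (j + p.+1)%N => //; lia.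
Qed.

Lemma component_right_end (H : subgraph C) (v : 'I_n) : is_induced H ->
  (v : vert C) \in sub_vert H -> (#|sub_vert H| < n)%N ->
  exists2 b : 'I_n, b \in right_ends (sub_vert H) /\ connect (adj H) v b &
    forall b' : 'I_n, b' \in right_ends (sub_vert H) -> connect (adj H) v b' -> b' = b.
Proof.
move=> Hi vH Hn; have [w [p [q [/andP[pq qn] vc nq run]]]] := component_run Hi vH Hn.
have q0 : (0 < q)%N by lia.
(* The run ends just before the missing position [q]; any earlier vertex has its successor in the
   run. *)
exists (cshift q.-1 w).
  split; last by apply/vc; exists q.-1 => //; lia.
  rewrite inE run; last lia.
  by rewrite -[ordS _]/(cshift q.-1.+1 w) prednK.
move=> b'; rewrite inE => /andP[_ nb'] /vc[j /andP[pj jq] bE]; rewrite bE; congr cshift.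
have : ~~ (p < j.+1 < q)%N.
  by apply: contraNN nb' => /run; rewrite -[cshift j.+1 w]/(ordS (cshift j w)) -bE.
lia.
Qed.

(** Every component is that of its right end, and two right ends in one component coincide. *)
Lemma card_components (H : subgraph C) : is_induced H ->
  (#|sub_vert H| < n)%N -> #|components H| = #|right_ends (sub_vert H)|.
Proof.
move=> Hi Hn.
have rv b : b \in right_ends (sub_vert H) -> (b : vert C) \in sub_vert H.
  by rewrite inE => /andP[].
have -> : components H = [set component H (v : vert C) | v in right_ends (sub_vert
  H)]%SET.
  apply/setP => K; apply/imsetP/imsetP => [[v vH ->]|[b bH ->]]; last first.
    by exists b => //; exact: rv.
  have [b [bB vb] _] := component_right_end Hi vH Hn.
  exists b => //; apply: val_inj; congr pair; apply/setP => u; rewrite !inE.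
    exact: same_connect (adj_sym H) _ _ vb _.
  by congr andb; exact: same_connect (adj_sym H) _ _ vb _.
apply: card_in_imset => b b' bB b'B e.
have [c _ cu] := component_right_end Hi (rv _ bB) Hn.
have bb' : connect (adj H) b b'.
  have /setP/(_ b') := congr1 (@sub_vert C) e.
  by rewrite !inE connect0.
by rewrite (cu b) ?connect0// (cu b').
Qed.

End Runs.

(** * Counting vertex sets by their right ends, and the binomial identity *)

Section Counting.
Context (n : nat) (n1 : (1 < n)%N).
Local Notation C := (cycle_graph n).
Implicit Types (i : 'I_n) (W : {set 'I_n}).

Lemma induced_on_subproof (W : {set vert C}) :
  is_subgraph (W, [set e | (src e \in W) && (tgt e \in W)]%SET).
Proof. by apply/forall_inP => e /=; rewrite inE. Qed.

(** Inverse to [sub_vert] on induced subgraphs; turns the sum over subgraphs into a sum over vertex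
    sets. *)
Definition induced_on W : subgraph C := Subgraph (induced_on_subproof W).

Lemma induced_onP W : is_induced (induced_on W).
Proof. by apply/forallP => e; apply/implyP => h; rewrite /sub_edge /= inE. Qed.

Lemma induced_onK (H : subgraph C) : is_induced H -> induced_on (sub_vert H) = H.
Proof.
move=> Hi; apply: val_inj => /=; rewrite [RHS]surjective_pairing; congr pair.
by apply/setP => e; rewrite inE -/(sub_edge H) induced_edge.
Qed.

Lemma ordS_neq i : ordS i != i.
Proof.
apply/eqP => h; have := @cshift_eq n 0 1 i; rewrite /cshift /= => /(_ (ltnW n1) n1) H.
by suff : 0%N = 1%N by []; apply: H.
Qed.

(** Removing [i] leaves an arbitrary set of [m - 1] vertices among the [n - 2] other than [i] and
    its successor. *)
Lemma card_right_end i m : (0 < m)%N ->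
  #|[set W : {set 'I_n} | [&& #|W| == m, i \in W & ordS i \notin W]]%SET| = 'C(n - 2, m
    - 1).
Proof.
move=> m0; pose B := (~: [set i; ordS i])%SET.
have cB : #|B| = (n - 2)%N by rewrite cardsCs finset.setCK cards2 eq_sym ordS_neq
  card_ord.
rewrite -cB -cards_draws -(@card_in_imset _ _ (fun A => i |: A)%SET); last first.
  move=> A A'; rewrite !inE => /andP[AB _] /andP[A'B _] /setP e; apply/setP => u.
  have [->|ui] := eqVneq u i; last by have := e u; rewrite !inE (negbTE ui).
  have nB : i \notin B by rewrite !inE eqxx.
  by rewrite (contraNF (fintype.subsetP AB _) nB) (contraNF (fintype.subsetP A'B _) nB).
apply: eq_card => W; rewrite inE; apply/idP/imsetP.
  move=> /and3P[/eqP Wm iW nW]; exists (W :\ i)%SET; last by rewrite finset.setD1K.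
  rewrite inE; apply/andP; split.
    apply/fintype.subsetP => u; rewrite !inE negb_or => /andP[-> uW] /=.
    by apply: contraNneq nW => <-.
  by have := cardsD1 i W; rewrite iW Wm => ->; rewrite add1n subn1.
move=> [A]; rewrite inE => /andP[AB /eqP Am] ->.
have niA : i \notin A by apply/negP => /(fintype.subsetP AB); rewrite !inE eqxx.
have nSA : ordS i \notin A by apply/negP => /(fintype.subsetP AB); rewrite !inE eqxx orbT.
apply/and3P; split.
- by rewrite cardsU1 niA Am add1n subn1 prednK.
- by rewrite !inE eqxx.
- by rewrite !inE negb_or ordS_neq.
Qed.

(** Double counting of the pairs formed by a set and one of its right ends. *)
Lemma sum_right_ends m : (0 < m)%N ->
  (\sum_(W : {set 'I_n} | #|W| == m) #|right_ends W| = n * 'C(n - 2, m - 1))%N.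
Proof.
move=> m0.
transitivity (\sum_(W : {set 'I_n} | #|W| == m) \sum_(i | i \in right_ends W) 1)%N.
  by apply: eq_bigr => W _; rewrite sum1_card.
rewrite (exchange_big_dep xpredT)//=.
rewrite (eq_bigr (fun=> 'C(n - 2, m - 1))); last first.
  move=> i _; rewrite sum1_card -(card_right_end i m0) cardsE; apply: eq_card => W.
  by rewrite -!topredE /= inE.
by rewrite big_const_ord iter_addn_0 mulnC.
Qed.

End Counting.

(** Induction on [m]: splitting off the term [j = 0] leaves the negative of the preceding sum. The
    absorption identity turns the split term into [n] times a binomial of [n - 1], and Pascal's rule
    matches the two sides. *)
Lemma alternating_binomial (R : comNzRingType) n m : (1 < n)%N -> (0 < m)%N ->
  \sum_(j < m) (-1) ^+ j * (m - j)%:R * 'C(n, m - j)%:R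
    = (n * 'C(n - 2, m - 1))%:R :> R.
Proof.
move=> n1; case: m => // m _; elim: m => [|m IH].
  by rewrite big_ord_recl big_ord0 addr0 /= expr0 !mul1r bin1 subnn bin0 muln1.
rewrite big_ord_recl /= expr0 mul1r subn0.
rewrite (eq_bigr (fun j : 'I_m.+1 => - ((-1) ^+ j * (m.+1 - j)%:R * 'C(n, m.+1 -
  j)%:R))); last first.
  by move=> j _; rewrite /bump /= add1n subSS exprS mulN1r !mulNr.
rewrite sumrN IH -natrM; apply/eqP; rewrite subr_eq -natrD; apply/eqP; congr _%:R.
case: n n1 {IH} => [|[|n]] // _; rewrite !subSS !subn0.
by rewrite -mul_bin_diag -mulnDr /= binS.
Qed.

Theorem theorem2p13 (R : realType) (n : nat) (hn : (3 <= n)%N)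
    (S : topologicalType) (hS : surface R S)
    (hconn : connected (setT : set S))
    (sigma : realization R (cycle_graph n) -> S) (hsigma : embedding sigma)
    (m : nat) (hm : (1 <= m < n)%N) :
  face_sum sigma m
    = (\sum_(j < m) (-1) ^+ j * (m - j)%:R * 'C(n, m - j)%:R)%:E
  /\ \sum_(j < m) (-1) ^+ j * (m - j)%:R * 'C(n, m - j)%:R
    = (n * 'C(n - 2, m - 1))%:R :> R.
Proof.
have [m0 mn] := andP hm; have n1 : (1 < n)%N by exact: ltnW.
have e := @alternating_binomial R n m n1 m0.
split=> //; rewrite e -(sum_right_ends n1 m0).
(* Each component is an arc with one face, so the faces of [H] are counted by its components, hence
   by its right ends; [m < n] makes the vertex set proper. *)
have faceE (H : subgraph (cycle_graph n)) : is_induced H && (#|sub_vert H| == m) ->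
    faces sigma H = (#|right_ends (sub_vert H)|%:R)%:E.
  move=> /andP[Hi /eqP Hm]; have Hn : (#|sub_vert H| < n)%N by rewrite Hm.
  rewrite /faces (eq_bigr (fun=> 1%:E)); last first.
    move=> K /imsetP[v vH ->].
    have [a [l [ln E]]] := @component_cycle_arc R n H v Hi vH Hn.
    exact: (faces_cycle_arc n1 hS hconn hsigma ln E).
  by rewrite sumEFin sumr_const (card_components Hi Hn).
rewrite /face_sum (eq_bigr _ faceE) sumEFin natr_sum; congr _%:E.
rewrite (reindex_onto (@induced_on n) (@sub_vert _)); last first.
  by move=> H /andP[Hi _]; exact: induced_onK.
by apply: eq_bigl => W; rewrite induced_onP eqxx andbT.
Qed.
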